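(* Let $(X,\mathfrak{F},\mu)$ be a standard probability space with an ergodic measure-preserving $\mathbb{Z}$-action $(T_n)$. Let $B$ be a separable Banach space with the Radon--Nikodym property, let $c:\mathbb{Z}\times X\to\mathrm{Isom}(B)$ be a Borel cocycle ($c(n+m,x)=c(n,x)c(m,T_nx)$, $(n,x)\mapsto c(n,x).b$ measurable), and let $s:X\times\mathbb{Z}\times\mathbb{Z}\to B$ satisfy $s_x(m,l)+s_x(l,n)=s_x(m,n)$, $c(k,x).s_{T_kx}(m,n)=s_x(m+k,n+k)$, with $x\mapsto s_x(m,n)$ weakly measurable and $x\mapsto\|s_x(0,n)\|_B$ integrable for all $n$. Suppose there is a weak*-compact subset $\mathcal{C}$ of the closed unit ball of $B^*$ with $c(n,x)^*\mathcal{C}\subseteq\mathcal{C}$ for all $n,x$, such that for every $n\ge1$ \[ \int_X\|s_x(0,n)\|_B\,d\mu(x)=\sup_{\lambda}\int_X\langle\lambda(x),s_x(0,n)\rangle\,d\mu(x), \] the supremum over weak*-measurable maps $\lambda:X\to\mathcal{C}$. Then there is a measurable map $\xi:X\to\mathcal{C}$ such that \[ \lim_{n\to\infty}\frac1n\langle\xi(x),s_x(0,n)\rangle=\lim_{n\to\infty}\frac1n\int_X\|s_x(0,n)\|_B\,d\mu(x) \] for $\mu$-almost every $x$.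
   Context: A Banach space $B$ has the Radon--Nikodym property if for every finite measure space $(X,\mathfrak{F},\mu)$ and every $\mu$-continuous $B$-valued vector measure $\nu$ of bounded variation there is a Bochner integrable $g:X\to B$ with $\nu(E)=\int_Eg\,d\mu$ for all $E\in\mathfrak{F}$. Weakly measurable: $x\mapsto\langle\phi,s_x(m,n)\rangle$ measurable for all $\phi\in B^*$. $c(n,x)^*$ is the adjoint of $c(n,x)$ acting on $B^*$. *)

(* Defs.v *)
From HB Require Import structures.
From mathcomp Require Import all_boot all_order all_algebra.
From mathcomp Require Import all_classical all_reals all_analysis.
Set Implicit Arguments. Unset Strict Implicit. Unset Printing Implicit Defensive.
Import Order.TTheory GRing.Theory Num.Theory.
Import numFieldNormedType.Exports.
Local Open Scope classical_set_scope.
Local Open Scope ring_scope.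

Section Defs.
Variable R : realType.

Definition separable_space (T : topologicalType) : Prop :=
  exists D : set T, countable D /\ closure D = setT.

Definition standard_borel (d : measure_display) (X : measurableType d) : Prop :=
  exists (P : completePseudoMetricType R) (f : X -> P),
    hausdorff_space P /\ separable_space P /\ bijective f /\
    forall A : set X, measurable A <-> <<s @open P >> (f @` A).

Definition borel_meas (d : measure_display) (X : measurableType d)
  (B : normedModType R) (f : X -> B) : Prop :=
  forall O : set B, open O -> measurable (f @^-1` O).

Definition is_dual (B : normedModType R) (phi : B -> R) : Prop :=
  (forall (a : R) (u v : B), phi (a *: u + v) = a * phi u + phi v) /\
  continuous phi.

Definition lin_isometry (B : normedModType R) (g : B -> B) : Prop :=
  (forall (a : R) (u v : B), g (a *: u + v) = a *: g u + g v) /\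
  (forall u, `|g u| = `|u|) /\ (forall v, exists u, g u = v).

Definition simple_fun (d : measure_display) (Y : measurableType d)
  (B : normedModType R) (h : Y -> B) : Prop :=
  finite_set (range h) /\ forall v, measurable (h @^-1` [set v]).

Definition simple_integral (d : measure_display) (Y : measurableType d)
  (B : normedModType R) (m : set Y -> \bar R) (E : set Y) (h : Y -> B) : B :=
  (\sum_(v \in range h) (fine (m (h @^-1` [set v] `&` E))) *: v)%R.

Definition bochner_integral (d : measure_display) (Y : measurableType d)
  (B : normedModType R) (m : {measure set Y -> \bar R}) (E : set Y)
  (g : Y -> B) (v : B) : Prop :=
  exists h : nat -> Y -> B,
    (forall k, simple_fun (h k)) /\
    {ae m, forall y, (fun k => h k y) @ \oo --> g y} /\
    (fun k => (\int[m]_y (`|h k y - g y|)%:E)%E) @ \oo --> 0%E /\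
    (fun k => simple_integral m E (h k)) @ \oo --> v.

Definition vector_measure (d : measure_display) (Y : measurableType d)
  (B : normedModType R) (nu : set Y -> B) : Prop :=
  forall F : nat -> set Y, (forall i, measurable (F i)) -> trivIset setT F ->
    (fun n => \sum_(i < n) nu (F i))%R @ \oo --> nu (\bigcup_i F i).

Definition bounded_variation (d : measure_display) (Y : measurableType d)
  (B : normedModType R) (nu : set Y -> B) : Prop :=
  exists M : R, forall (n : nat) (E : nat -> set Y),
    (forall i, measurable (E i)) -> trivIset setT E ->
    (forall y, exists i, (i < n)%N /\ E i y) ->
    (\sum_(i < n) `|nu (E i)|)%R <= M.

Definition abs_continuous (d : measure_display) (Y : measurableType d)
  (B : normedModType R) (m : set Y -> \bar R) (nu : set Y -> B) : Prop :=
  forall E, measurable E -> m E = 0%E -> nu E = 0%R.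

Definition RNP (B : normedModType R) : Prop :=
  forall (d : measure_display) (Y : measurableType d)
    (m : {finite_measure set Y -> \bar R}) (nu : set Y -> B),
    vector_measure nu -> bounded_variation nu -> abs_continuous m nu ->
    exists g : Y -> B, (exists v, bochner_integral m setT g v) /\
      forall E, measurable E -> bochner_integral m E g (nu E).

End Defs.

(* Main.v *)
Require Import Defs.
From HB Require Import structures.
From mathcomp Require Import all_boot all_order all_algebra.
From mathcomp Require Import all_classical all_reals all_analysis.
From mathcomp Require Import measurable_realfun ring lra zify.
Import Order.TTheory GRing.Theory Num.Theory.
Import numFieldNormedType.Exports.
Local Open Scope classical_set_scope.
Local Open Scope ring_scope.

Set Implicit Arguments.
Unset Strict Implicit.
Unset Printing Implicit Defensive.

(** The norms [a n x = |s_x(0,n)|] form a subadditive cocycle over [T_1]; let [L]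
    be the limit of [(int a n) / n]. For almost every [x] and every [n] the
    hypothesis yields an element of [C] that nearly norms [s_x(0,n)]. Along the
    orbit of [x], such a functional grows at rate at least [L - e] over all
    sufficiently long time intervals, except from a small proportion of starting
    times: this is a maximal inequality, in which the increments outside the bad
    intervals are controlled by the [L^1] form of Kingman's upper bound. Since [C]
    is invariant, shifting back along the orbit produces, on a set of measure
    close to 1, functionals [phi] in [C] with [phi (s_x(0,l)) >= (L - e_j) l] for
    all [j] and all [l >= K_j], first for finitely many pairs [(j,l)] and then,
    by weak* compactness, for all of them. Such a functional has growth rate
    exactly [L], because [|s_x(0,l)|] has rate at most [L]. It is selected
    measurably by successive minimization at the points of a dense sequence. *)

(** * Integration of real functions *)

Section RealIntegrable.
Context {R : realType} {d : measure_display} {X : measurableType d}.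
Variable mu : probability X R.

Definition Rintegrable (f : X -> R) := mu.-integrable setT (EFin \o f).

Lemma Rintegrable_measurable f : Rintegrable f -> measurable_fun setT f.
Proof. by move=> /(measurable_int mu) /measurable_EFinP. Qed.

Lemma eq_Rintegrable f g : f =1 g -> Rintegrable f -> Rintegrable g.
Proof. by move=> /funext ->. Qed.

Lemma RintegrableD f g : Rintegrable f -> Rintegrable g ->
  Rintegrable (fun x => f x + g x).
Proof. by move=> fi gi; exact: (integrableD measurableT fi gi). Qed.

Lemma RintegrableZ r f : Rintegrable f -> Rintegrable (fun x => r * f x).
Proof. by move=> fi; exact: (integrableZl measurableT r fi). Qed.

Lemma RintegrableN f : Rintegrable f -> Rintegrable (fun x => - f x).
Proof.
by move=> /(RintegrableZ (-1)); apply: eq_Rintegrable => x; rewrite mulN1r.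
Qed.

Lemma RintegrableB f g : Rintegrable f -> Rintegrable g ->
  Rintegrable (fun x => f x - g x).
Proof. by move=> fi /RintegrableN; exact: RintegrableD. Qed.

Lemma Rintegrable_cst r : Rintegrable (fun=> r).
Proof. exact: finite_measure_integrable_cst. Qed.

Lemma Rintegrable_sum n (f : nat -> X -> R) : (forall i, Rintegrable (f i)) ->
  Rintegrable (fun x => \sum_(i < n) f i x).
Proof.
move=> fi; elim: n => [|n IH].
  by apply: eq_Rintegrable (Rintegrable_cst 0) => x; rewrite big_ord0.
by apply: eq_Rintegrable (RintegrableD IH (fi n)) => x; rewrite big_ord_recr.
Qed.

Lemma le_Rintegrable (f g : X -> R) : measurable_fun setT f ->
  (forall x, `|f x| <= g x) -> Rintegrable g -> Rintegrable f.
Proof.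
move=> mf fg gi; apply: (le_integrable measurableT _ _ gi) => [|x _].
  exact/measurable_EFinP.
by rewrite /= lee_fin (le_trans (fg x))// ler_norm.
Qed.

Lemma Rintegrable_abs f : Rintegrable f -> Rintegrable (fun x => `|f x|).
Proof. exact: integrable_norm. Qed.

Lemma Rintegrable_max f g : Rintegrable f -> Rintegrable g ->
  Rintegrable (fun x => Num.max (f x) (g x)).
Proof.
move=> fi gi; apply: (@le_Rintegrable _ (fun x => `|f x| + `|g x|)).
- by apply: measurable_maxr; exact: Rintegrable_measurable.
- move=> x; case: (leP (f x) (g x)) => _; first by rewrite lerDr.
  by rewrite lerDl.
- by apply: RintegrableD; exact: Rintegrable_abs.
Qed.

Lemma Rintegrable_min f g : Rintegrable f -> Rintegrable g ->
  Rintegrable (fun x => Num.min (f x) (g x)).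
Proof.
move=> /RintegrableN fi /RintegrableN gi.
apply: eq_Rintegrable (RintegrableN (Rintegrable_max fi gi)) => x.
by rewrite oppr_max !opprK.
Qed.

Lemma RintegralT_sum n (f : nat -> X -> R) : (forall i, Rintegrable (f i)) ->
  \int[mu]_x (\sum_(i < n) f i x) = \sum_(i < n) \int[mu]_x f i x.
Proof.
move=> fi; elim: n => [|n IH].
  rewrite big_ord0; under eq_Rintegral do rewrite big_ord0.
  by rewrite Rintegral_cst// mul0r.
rewrite big_ord_recr /= -IH -RintegralD//; [|exact: Rintegrable_sum|exact: fi].
by apply: eq_Rintegral => x _; rewrite big_ord_recr.
Qed.

Lemma RintegralT_cst (r : R) : \int[mu]_x r = r.
Proof.
rewrite Rintegral_cst// (_ : fine _ = 1) ?mulr1//.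
exact: (congr1 fine (probability_setT mu)).
Qed.

Lemma RintegralTD f g : Rintegrable f -> Rintegrable g ->
  \int[mu]_x (f x + g x) = \int[mu]_x f x + \int[mu]_x g x.
Proof. exact: RintegralD. Qed.

Lemma RintegralTB f g : Rintegrable f -> Rintegrable g ->
  \int[mu]_x (f x - g x) = \int[mu]_x f x - \int[mu]_x g x.
Proof. exact: RintegralB. Qed.

Lemma RintegralTZ r f : Rintegrable f ->
  \int[mu]_x (r * f x) = r * \int[mu]_x f x.
Proof. exact: RintegralZl. Qed.

Lemma le_RintegralT f g : Rintegrable f -> Rintegrable g ->
  (forall x, f x <= g x) -> \int[mu]_x f x <= \int[mu]_x g x.
Proof. by move=> fi gi fg; apply: le_Rintegral. Qed.

Lemma EFin_RintegralT f : Rintegrable f ->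
  (\int[mu]_x f x)%:E = (\int[mu]_x (f x)%:E)%E.
Proof. by move=> fi; rewrite /Rintegral fineK// integrable_fin_num. Qed.

Lemma Rdominated_convergence (f_ : nat -> X -> R) (f g : X -> R) :
  (forall n, measurable_fun setT (f_ n)) -> measurable_fun setT f ->
  {ae mu, forall x, f_ ^~ x @ \oo --> f x} -> Rintegrable g ->
  (forall n x, `|f_ n x| <= g x) ->
  (fun n => \int[mu]_x f_ n x) @ \oo --> \int[mu]_x f x.
Proof.
move=> mf_ mf cf gi fg.
have [|||||] := @dominated_convergence _ _ _ mu setT measurableT
  (fun n => EFin \o f_ n) (EFin \o f) (EFin \o g).
- by move=> n; exact/measurable_EFinP.
- exact/measurable_EFinP.
- apply: filterS cf => x cx _.
  by apply: cvg_EFin => //; exact: nearW.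
- exact: gi.
- by apply: aeW => x n _; rewrite lee_fin.
move=> fi _; rewrite -(EFin_RintegralT fi) => /fine_cvgP[_].
exact.
Qed.

End RealIntegrable.

(** * Upper bounds for linear growth *)

Section LinearGrowth.
Context {R : realType}.
Implicit Types (u v : nat -> R) (c : R).

(** The upper limit of [u n / n] is at most [c], written without division so that such bounds add
    and shift easily. *)
Definition linear_upper u c :=
  forall e : R, 0 < e -> exists N, forall n, (N <= n)%N -> u n <= n%:R * (c + e).

Lemma nat_archi (x : R) : exists n : nat, x <= n%:R.
Proof. by exists (Num.truncn x).+1; exact/ltW/truncnS_gt. Qed.

Lemma invS_le (e : R) : 0 < e -> exists k : nat, k.+1%:R^-1 <= e.
Proof.
move=> e0; have [k hk] := nat_archi e^-1; exists k.
rewrite -[leRHS]invrK lef_pV2 ?posrE ?invr_gt0// (le_trans hk)//.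
by rewrite ler_nat.
Qed.

(** A bounded error is absorbed by half of [e] for large [n]. Only countably many slopes have to be
    checked, so that almost everywhere statements can be combined over [k]. *)
Lemma linear_upper_bounded u c :
  (forall k : nat, exists M, forall n, u n <= n%:R * (c + k.+1%:R^-1) + M) ->
  linear_upper u c.
Proof.
move=> h e e0; have e20 : 0 < e / 2 by rewrite divr_gt0.
have [k ke] := invS_le e20; have [M hM] := h k.
have [N hN] := nat_archi (M / (e / 2)); exists N => n Nn.
apply: le_trans (hM n) _.
have : M <= n%:R * (e / 2).
  rewrite -ler_pdivrMr// (le_trans hN)// ler_nat//.
have : n%:R * k.+1%:R^-1 <= n%:R * (e / 2) :> R by rewrite ler_wpM2l.
move: (k.+1%:R^-1) (n%:R) => q m; lra.
Qed.

Lemma linear_upperW u v c : (forall n, u n <= v n) ->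
  linear_upper v c -> linear_upper u c.
Proof.
by move=> uv h e /h[N hN]; exists N => n /hN; exact: le_trans.
Qed.

Lemma linear_upperD u v c c' : linear_upper u c -> linear_upper v c' ->
  linear_upper (fun n => u n + v n) (c + c').
Proof.
move=> hu hv e e0; have e20 : 0 < e / 2 by rewrite divr_gt0.
have [N hN] := hu _ e20; have [N' hN'] := hv _ e20.
exists (maxn N N') => n; rewrite geq_max => /andP[/hN h1 /hN' h2].
apply: le_trans (lerD h1 h2) _; lra.
Qed.

Lemma linear_upper_cst (M : R) : linear_upper (fun=> M) 0.
Proof.
by apply: linear_upper_bounded => k; exists M => n; rewrite lerDr mulr_ge0 ?add0r.
Qed.

Lemma linear_upper_shift u c : linear_upper u c ->
  linear_upper (fun n => u n.+1) c.
Proof.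
move=> hu e e0; have e20 : 0 < e / 2 by rewrite divr_gt0.
have [N hN] := hu _ e20.
have [N' hN'] := linear_upper_cst (c + e/2) e20.
exists (maxn N N') => n; rewrite geq_max => /andP[Nn N'n].
apply: le_trans (hN _ (leq_trans Nn (leqnSn n))) _.
have := hN' _ N'n; rewrite -(natr1 n); lra.
Qed.

Lemma linear_upper_cvg u c : linear_upper u c ->
  linear_upper (fun n => - u n) (- c) -> (fun n => u n / n%:R) @ \oo --> c.
Proof.
move=> hu hl; apply/cvgrPdist_le => e e0.
have [N hN] := hu _ e0; have [N' hN'] := hl _ e0.
exists (N + N').+1 => // n NN'n.
have [Nn N'n n1] : [/\ (N <= n)%N, (N' <= n)%N & (0 < n)%N].
  have {}NN'n : (N + N' < n)%N := NN'n.
  by split; lia.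
have n0 : 0 < n%:R :> R by rewrite ltr0n.
have := hN _ Nn; have := hN' _ N'n => h1 h2.
rewrite ler_distlC; apply/andP; split.
  rewrite ler_pdivlMr//; lra.
rewrite ler_pdivrMr//; lra.
Qed.

(** Letting [n] grow removes the constant; this disposes of boundary terms independent of the length
    of the orbit. *)
Lemma le_linear_slope (q r c : R) :
  (forall n : nat, n%:R * q <= n%:R * r + c) -> q <= r.
Proof.
move=> h; rewrite leNgt; apply/negP => rq.
have qr0 : 0 < q - r by rewrite subr_gt0.
have [n hn] := nat_archi (c / (q - r) + 1).
have : c + (q - r) <= n%:R * (q - r).
  by rewrite -ler_pdivrMr// mulrDl divff ?gt_eqF.
have := h n; lra.
Qed.

Lemma cvg_min_cst u (l c : R) : u @ \oo --> l ->
  (fun n => Num.min (u n) c) @ \oo --> Num.min l c.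
Proof.
move=> /cvgrPdist_le ul; apply/cvgrPdist_le => e e0.
apply: filterS (ul e e0) => n; apply: le_trans.
rewrite ler_norml; have := ler_norm (l - u n); have := ler_norm (u n - l).
by rewrite distrC; case: (leP l c); case: (leP (u n) c); lra.
Qed.

End LinearGrowth.

Section RealIntegralComplements.
Context {R : realType} {d : measure_display} {X : measurableType d}.
Variable mu : probability X R.

Lemma ae_le_RintegralT (f g : X -> R) : Rintegrable mu f -> Rintegrable mu g ->
  {ae mu, forall x, f x <= g x} -> \int[mu]_x f x <= \int[mu]_x g x.
Proof.
move=> fi gi fg; have mi := Rintegrable_min fi gi.
have -> : \int[mu]_x f x = \int[mu]_x Num.min (f x) (g x).
  rewrite /Rintegral; congr fine; apply: ae_eq_integral => //.
  - by apply/measurable_EFinP; exact: Rintegrable_measurable fi.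
  - by apply/measurable_EFinP; exact: Rintegrable_measurable mi.
  - by apply: filterS fg => x fgx _; rewrite min_l.
by apply: le_RintegralT => // x; rewrite ge_min lexx orbT.
Qed.

Lemma Rintegrable_indic (A : set X) : measurable A -> Rintegrable mu (\1_A : X -> R).
Proof.
move=> mA; apply: (@le_Rintegrable _ _ _ _ _ (fun=> 1)).
- exact: measurable_indic.
- by move=> x; rewrite indicE normr_nat lern1 leq_b1.
- exact: Rintegrable_cst.
Qed.

Lemma RintegralT_indic (A : set X) : measurable A ->
  \int[mu]_x (\1_A x : R) = fine (mu A).
Proof. by move=> mA; rewrite /Rintegral integral_indic// setIT. Qed.

(** The truncated parts vanish pointwise from some [n] on and are dominated by [g]. *)
Lemma tail_small (g : X -> R) e : Rintegrable mu g -> (forall x, 0 <= g x) -> 0 < e ->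
  exists M : nat, \int[mu]_x Num.max (g x - M%:R) 0 <= e.
Proof.
move=> gi g0 e0.
pose t n x := Num.max (g x - n%:R) 0.
have ti n : Rintegrable mu (t n).
  by apply: Rintegrable_max; [apply: RintegrableB|]; try exact: Rintegrable_cst.
have : (fun n => \int[mu]_x t n x) @ \oo --> \int[mu]_x (0 : R).
  apply: (@Rdominated_convergence _ _ _ _ _ _ g) => //.
  - by move=> n; exact: Rintegrable_measurable (ti n).
  - apply: aeW => x; have [N hN] := nat_archi (g x).
    apply: cvg_near_cst; exists N => // n Nn; rewrite /t; apply/max_idPr.
    by rewrite subr_le0 (le_trans hN)// ler_nat.
  - move=> n x; rewrite ger0_norm; last by rewrite /t le_max lexx orbT.
    by rewrite /t ge_max g0 andbT gerBl.
rewrite RintegralT_cst => /cvgrPdist_le /(_ e e0) [N _ hN].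
exists N; have := hN N (leqnn N); rewrite sub0r normrN; apply: le_trans.
exact: ler_norm.
Qed.

End RealIntegralComplements.

(* To be applied to integrands [lam x (y x)], whose measurability in [x] is not
   known a priori. *)
Lemma le_integral_pointwise {R : realType} {d : measure_display} {X : measurableType d}
    (mu : {measure set X -> \bar R}) (f g : X -> \bar R) :
  (forall x, f x <= g x)%E -> (\int[mu]_x f x <= \int[mu]_x g x)%E.
Proof.
move=> fg; rewrite /integral !patch_setT.
apply: leeB; apply: ereal_sup_le => _ [h hle <-]; exists h => // x;
  apply: le_trans (hle x) _.
  by apply: (@funepos_le _ _ setT) (in_setT x) => z _; exact: fg.
by apply: (@funeneg_le _ _ setT) (in_setT x) => z _; exact: fg.
Qed.

(** * Birkhoff's ergodic theorem *)

Section MeasurePreserving.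
Context {R : realType} {d : measure_display} {X : measurableType d}.
Variables (mu : probability X R) (tau : X -> X).
Hypothesis mtau : measurable_fun setT tau.
Hypothesis ptau : forall A, measurable A -> mu (tau @^-1` A) = mu A.

Let tau_mixin := isMeasurableFun.Build _ _ _ _ _ mtau.
Let tau_pack : {mfun X >-> X} := HB.pack tau tau_mixin.

Lemma integral_measure_preserving (f : X -> \bar R) :
  (\int[pushforward mu tau]_x f x = \int[mu]_x f x)%E.
Proof.
by apply: (@eq_measure_integral _ _ _ setT mu (pushforward mu tau_pack)) => A mA _;
  exact: ptau.
Qed.

Lemma Rintegrable_comp f : Rintegrable mu f -> Rintegrable mu (f \o tau).
Proof.
move=> fi; have mf := Rintegrable_measurable fi.
have mft : measurable_fun setT (f \o tau) by exact: measurableT_comp.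
apply/integrableP; split; first exact/measurable_EFinP.
have /integrableP[_] := fi.
rewrite -integral_measure_preserving ge0_integral_pushforward//.
by apply: measurableT_comp => //; exact/measurable_EFinP.
Qed.

Lemma RintegralT_comp f : Rintegrable mu f ->
  \int[mu]_x f (tau x) = \int[mu]_x f x.
Proof.
move=> fi; have mf := Rintegrable_measurable fi.
rewrite /Rintegral; congr fine.
rewrite -[RHS]integral_measure_preserving integral_pushforward//.
  exact/measurable_EFinP.
exact: Rintegrable_comp.
Qed.

End MeasurePreserving.

Section Birkhoff.
Context {R : realType} {d : measure_display} {X : measurableType d}.
Variables (mu : probability X R) (tau : X -> X).
Hypothesis mtau : measurable_fun setT tau.
Hypothesis ptau : forall A, measurable A -> mu (tau @^-1` A) = mu A.
Hypothesis erg : forall A, measurable A -> tau @^-1` A = A ->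
  mu A = 0%E \/ mu A = 1%E.
Implicit Types g : X -> R.

Definition birkhoff_sum g n x := \sum_(i < n) g (iter i tau x).

(* The running maximum [max_(k <= n) birkhoff_sum g k], in recursive form. *)
Fixpoint birkhoff_max g n x : R :=
  if n is n'.+1 then Num.max 0 (g x + birkhoff_max g n' (tau x)) else 0.

Lemma birkhoff_sumS g n x :
  birkhoff_sum g n.+1 x = g x + birkhoff_sum g n (tau x).
Proof.
rewrite /birkhoff_sum big_ord_recl; congr (_ + _).
by apply: eq_bigr => i _; rewrite -iterSr.
Qed.

Lemma birkhoff_sumSr g n x :
  birkhoff_sum g n.+1 x = birkhoff_sum g n x + g (iter n tau x).
Proof. exact: big_ord_recr. Qed.

Lemma Rintegrable_iter g n : Rintegrable mu g ->
  Rintegrable mu (fun x => g (iter n tau x)).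
Proof.
move=> gi; elim: n => [//|n IH].
by apply: eq_Rintegrable (Rintegrable_comp mtau ptau IH) => x /=; rewrite -iterS iterSr.
Qed.

Lemma RintegralT_iter g n : Rintegrable mu g ->
  \int[mu]_x g (iter n tau x) = \int[mu]_x g x.
Proof.
move=> gi; elim: n => [//|n IH].
rewrite -IH -(RintegralT_comp mtau ptau (Rintegrable_iter n gi)).
by apply: eq_Rintegral => x _; rewrite iterSr.
Qed.

Lemma Rintegrable_birkhoff_sum g n : Rintegrable mu g ->
  Rintegrable mu (birkhoff_sum g n).
Proof.
move=> gi; apply: (@Rintegrable_sum _ _ _ mu n (fun i x => g (iter i tau x))) => i.
exact: Rintegrable_iter.
Qed.

Lemma RintegralT_birkhoff_sum g n : Rintegrable mu g ->
  \int[mu]_x birkhoff_sum g n x = n%:R * \int[mu]_x g x.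
Proof.
move=> gi; rewrite (@RintegralT_sum _ _ _ mu n (fun i x => g (iter i tau x))); last first.
  by move=> i; exact: Rintegrable_iter.
under eq_bigr do rewrite RintegralT_iter//.
by rewrite sumr_const card_ord mulr_natl.
Qed.

Lemma birkhoff_max_ge0 g n x : 0 <= birkhoff_max g n x.
Proof. by case: n => //= n; rewrite le_max lexx. Qed.

Lemma birkhoff_max_leS g n x : birkhoff_max g n x <= birkhoff_max g n.+1 x.
Proof.
elim: n x => [x|n IH x]; first exact: birkhoff_max_ge0.
change (Num.max 0 (g x + birkhoff_max g n (tau x)) <=
  Num.max 0 (g x + birkhoff_max g n.+1 (tau x))).
by rewrite ge_max !le_max lexx /= lerD2l IH orbT.
Qed.

Lemma birkhoff_max_nd g x m n : (m <= n)%N ->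
  birkhoff_max g m x <= birkhoff_max g n x.
Proof.
move=> /subnK <-; elim: (n - m)%N => [//|k IH].
by rewrite addSn (le_trans IH)// birkhoff_max_leS.
Qed.

Lemma birkhoff_sum_le_max g n x : birkhoff_sum g n x <= birkhoff_max g n x.
Proof.
elim: n x => [x|n IH x]; first by rewrite /birkhoff_sum big_ord0.
by rewrite birkhoff_sumS /= le_max lerD2l IH orbT.
Qed.

Lemma Rintegrable_birkhoff_max g n : Rintegrable mu g ->
  Rintegrable mu (birkhoff_max g n).
Proof.
move=> gi; elim: n => [|n IH]; first exact: Rintegrable_cst.
apply: Rintegrable_max; first exact: Rintegrable_cst.
by apply: RintegrableD gi _; exact: (Rintegrable_comp mtau ptau IH).
Qed.

(** The set where the Birkhoff sums have supremum [+oo]; natural thresholds make it a countable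
    intersection. *)
Definition birkhoff_unbounded g :=
  [set x | forall c : nat, exists n, c%:R < birkhoff_max g n x].

(** The recursion from [tau x] to [x] adds the fixed number [g x] and truncates at 0, which does not
    affect unboundedness. *)
Lemma birkhoff_unbounded_invariant g :
  tau @^-1` birkhoff_unbounded g = birkhoff_unbounded g.
Proof.
apply/seteqP; split => x /= ux c.
  have [k hk] := nat_archi (c%:R - g x).
  have [n hn] := ux k; exists n.+1 => /=.
  by rewrite lt_max; apply/orP; right; lra.
have [k hk] := nat_archi (c%:R + g x).
have [] := ux k; case=> [|n] /=; first by rewrite ltNge ler0n.
by rewrite lt_max ltNge ler0n/= => hn; exists n; lra.
Qed.

Lemma measurable_birkhoff_unbounded g : Rintegrable mu g ->
  measurable (birkhoff_unbounded g).
Proof.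
move=> gi; rewrite (_ : birkhoff_unbounded g =
  \bigcap_(c : nat) \bigcup_n (birkhoff_max g n @^-1` `]c%:R, +oo[)).
  apply: bigcapT_measurable => c; apply: bigcupT_measurable => n.
  rewrite -[X in measurable X]setTI; apply: Rintegrable_measurable => //.
  exact: Rintegrable_birkhoff_max.
apply/seteqP; split => x ux.
  by move=> c _; have [n hn] := ux c; exists n => //=; rewrite in_itv/= andbT.
by move=> c; have [n _] := ux c I; rewrite /= in_itv/= andbT; exists n.
Qed.

(* With M_n = birkhoff_max g n, the function D_n = max (- M_n o tau) g equals
   M_(n+1) - M_n o tau, so its integral is nonnegative; and D_n decreases to g
   wherever M_n is unbounded. *)
Lemma maximal_ergodic g : Rintegrable mu g ->
  {ae mu, forall x, birkhoff_unbounded g x} -> 0 <= \int[mu]_x g x.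
Proof.
move=> gi aeu.
pose D n x := Num.max (- birkhoff_max g n (tau x)) (g x).
have Mti n : Rintegrable mu (fun x => birkhoff_max g n (tau x)).
  exact: Rintegrable_comp (Rintegrable_birkhoff_max _ gi).
have Di n : Rintegrable mu (D n) by apply: Rintegrable_max => //; exact: RintegrableN.
have D0 n : 0 <= \int[mu]_x D n x.
  have -> : \int[mu]_x D n x =
      \int[mu]_x (birkhoff_max g n.+1 x - birkhoff_max g n (tau x)).
    apply: eq_Rintegral => x _; rewrite /D /=.
    by case: leP => ?; case: leP => ?; lra.
  rewrite RintegralTB//; last exact: Rintegrable_birkhoff_max.
  rewrite (RintegralT_comp mtau ptau (Rintegrable_birkhoff_max n gi)) subr_ge0.
  apply: le_RintegralT => [||x]; [exact: Rintegrable_birkhoff_max..|].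
  exact: birkhoff_max_leS.
have : (fun n => \int[mu]_x D n x) @ \oo --> \int[mu]_x g x.
  apply: (@Rdominated_convergence _ _ _ _ _ _ (fun x => `|g x|)).
  - by move=> n; exact: Rintegrable_measurable (Di n).
  - exact: Rintegrable_measurable gi.
  - apply: filterS aeu => x; rewrite -birkhoff_unbounded_invariant => ux.
    have [k hk] := nat_archi (- g x); have [N hN] := ux k.
    apply: cvg_near_cst; exists N => //= n Nn.
    rewrite /D; apply/max_idPr; have := birkhoff_max_nd g (tau x) Nn; lra.
  - exact: Rintegrable_abs.
  - move=> n x; rewrite /D; have := birkhoff_max_ge0 g n (tau x).
    case: (leP (- birkhoff_max g n (tau x)) (g x)) => [_|h1 h2]; first by [].
    rewrite normrN ger0_norm// ler_normr.
    by apply/orP; right; lra.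
by move=> /cvgr_to_ge; apply; exact: nearW.
Qed.

(** The function [g - I - 1/(k+1)] has negative integral, so by [maximal_ergodic] its sums cannot be
    unbounded above almost everywhere. By ergodicity they are bounded above almost everywhere. *)
Lemma birkhoff_upper g : Rintegrable mu g ->
  {ae mu, forall x, linear_upper (birkhoff_sum g ^~ x) (\int[mu]_x g x)}.
Proof.
move=> gi; set I := \int[mu]_x g x.
suff /ae_foralln : forall k : nat, {ae mu, forall x, exists M, forall n,
    birkhoff_sum g n x <= n%:R * (I + k.+1%:R^-1) + M}.
  by apply: filterS => x hx; exact: linear_upper_bounded.
move=> k; pose g' x := g x - (I + k.+1%:R^-1).
have gi' : Rintegrable mu g' by apply: RintegrableB => //; exact: Rintegrable_cst.
have mA := measurable_birkhoff_unbounded gi'.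
have [A0|A1] := erg mA (birkhoff_unbounded_invariant g'); last first.
  have : 0 <= \int[mu]_x g' x.
    apply: maximal_ergodic => //; exists (~` birkhoff_unbounded g'); split => //.
      exact: measurableC.
    by rewrite probability_setC// A1 subee.
  rewrite RintegralTB//; last exact: Rintegrable_cst.
  rewrite RintegralT_cst -/I => h.
  have : 0 < k.+1%:R^-1 :> R by rewrite invr_gt0.
  by move: h; move: (k.+1%:R^-1) => q h q0; exfalso; clear A1; lra.
exists (birkhoff_unbounded g'); split => // x /=; apply: contra_notP.
move=> /existsNP[c hc]; exists c%:R => n.
have gE : birkhoff_sum g' n x = birkhoff_sum g n x - n%:R * (I + k.+1%:R^-1).
  by rewrite /birkhoff_sum sumrB sumr_const card_ord mulr_natl.
have : birkhoff_max g' n x <= c%:R.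
  by rewrite leNgt; apply/negP => cn; apply: hc; exists n.
have := birkhoff_sum_le_max g' n x; rewrite gE.
move: (k.+1%:R^-1) (birkhoff_max _ _ _) => q m h1 h2; lra.
Qed.

Lemma birkhoff_lower g : Rintegrable mu g ->
  {ae mu, forall x, linear_upper (fun n => - birkhoff_sum g n x) (- \int[mu]_x g x)}.
Proof.
move=> gi; apply: filterS (birkhoff_upper (RintegrableN gi)) => x.
rewrite (_ : \int[mu]_x - g x = - \int[mu]_x g x).
  by apply: linear_upperW => n; rewrite /birkhoff_sum sumrN.
rewrite -mulN1r -RintegralTZ//.
by apply: eq_Rintegral => y _; rewrite mulN1r.
Qed.

End Birkhoff.

(** * Subadditive cocycles *)

(** [L] is the infimum of [u n / n] over positive [n]; a nearly minimal block length and division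
    with remainder give the upper bound. *)
Lemma fekete {R : realType} (u : nat -> R) : (forall n, 0 <= u n) ->
  (forall m n, u (m + n)%N <= u m + u n) ->
  exists2 L : R, (forall n, n%:R * L <= u n) & linear_upper u L.
Proof.
move=> u0 uD; pose Q := [set u n.+1 / n.+1%:R | n in [set: nat]].
have Qlb : has_inf Q.
  split; first by exists (u 1%N / 1); exists 0%N.
  by exists 0 => _ [n _ <-]; rewrite divr_ge0.
exists (inf Q).
  move=> [|n]; first by rewrite mul0r.
  rewrite mulrC -ler_pdivlMr ?ltr0n//.
  by apply: ge_inf; [exact: Qlb.2|exists n].
apply: linear_upper_bounded => k.
have e0 : 0 < k.+1%:R^-1 :> R by rewrite invr_gt0.
have [_ [N _ <-]] := inf_adherent e0 Qlb.
rewrite ltr_pdivrMr ?ltr0n// => hN.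
(* As [u] is nonnegative, this sum bounds [u] at every remainder modulo [N.+1]. *)
exists (\sum_(i < N.+1) u i) => n.
have uq q r : u (q * N.+1 + r)%N <= q%:R * u N.+1 + u r.
  elim: q => [|q IH]; first by rewrite mul0r add0r.
  rewrite mulSn -addnA; apply: le_trans (uD _ _) _.
  by rewrite -(natr1 q); lra.
have ur : u (n %% N.+1)%N <= \sum_(i < N.+1) u i.
  rewrite (bigD1 (Ordinal (ltn_pmod n (ltn0Sn N))))//= lerDl.
  exact: sumr_ge0.
rewrite {1}(divn_eq n N.+1); apply: le_trans (uq _ _) _.
set q := (n %/ N.+1)%N; set c := inf Q + _ in hN *.
have c0 : 0 <= c.
  have : 0 < N.+1%:R * c by rewrite mulrC; exact: le_lt_trans hN.
  by rewrite pmulr_rgt0 ?ltr0n// => /ltW.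
apply: lerD ur; apply: le_trans (_ : q%:R * (c * N.+1%:R) <= _).
  by rewrite ler_wpM2l// ltW.
rewrite mulrCA -natrM mulrC ler_wpM2r// ler_nat.
exact: leq_trunc_div.
Qed.

Section SubadditiveCocycle.
Context {R : realType} {d : measure_display} {X : measurableType d}.
Variables (mu : probability X R) (tau : X -> X).
Hypothesis mtau : measurable_fun setT tau.
Hypothesis ptau : forall A, measurable A -> mu (tau @^-1` A) = mu A.
Hypothesis erg : forall A, measurable A -> tau @^-1` A = A ->
  mu A = 0%E \/ mu A = 1%E.
Context {B : normedModType R} (s : X -> nat -> nat -> B).
Hypothesis sD : forall x m l n, s x m l + s x l n = s x m n.
Hypothesis s_shift : forall k x m n,
  `|s (iter k tau x) m n| = `|s x (m + k)%N (n + k)%N|.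
Hypothesis s_int : forall n, Rintegrable mu (fun x => `|s x 0%N n|).

Local Notation a n x := `|s x 0%N n|.
Local Notation A n := (\int[mu]_x a n x).
Local Notation E N := (birkhoff_sum tau (fun x => a 1%N x) N).

Lemma cocycle_diag x m : s x m m = 0.
Proof. by apply: (addrI (s x m m)); rewrite sD addr0. Qed.

Lemma cocycle_sub x m n : s x 0%N n - s x 0%N m = s x m n.
Proof. by rewrite -(sD x 0%N m n) addrAC subrr add0r. Qed.

Lemma norm_cocycle_shift x k n : `|s x k (k + n)%N| = a n (iter k tau x).
Proof. by rewrite s_shift add0n addnC. Qed.

Lemma norm_cocycleD x m n : a (m + n)%N x <= a m x + a n (iter m tau x).
Proof. by rewrite -norm_cocycle_shift -(sD x 0%N m) ler_normD. Qed.

Lemma norm_cocycle_le n x : a n x <= E n x.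
Proof.
elim: n x => [x|n IH x]; first by rewrite cocycle_diag normr0 /birkhoff_sum big_ord0.
by rewrite birkhoff_sumS; apply: le_trans (norm_cocycleD x 1 n) _; rewrite lerD2l IH.
Qed.

Lemma birkhoff_norm_nd m n x : (m <= n)%N -> E m x <= E n x.
Proof.
move=> /subnKC <-; rewrite /birkhoff_sum big_split_ord /= lerDl.
exact: sumr_ge0.
Qed.

Lemma birkhoff_norm_ge0 N x : 0 <= E N x.
Proof. exact: sumr_ge0. Qed.

(** A moving average of the path [s x 0 i]. It stays within a distance controlled by [E N] of the
    path, while each step is [1/N] times a block of length [N]. *)
Definition smoothed N x i : B := N%:R^-1 *: \sum_(j < N) s x 0%N (i + j)%N.

Lemma smoothed_step N x i :
  smoothed N x i.+1 - smoothed N x i = N%:R^-1 *: s x i (i + N)%N.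
Proof.
rewrite /smoothed -scalerBr -sumrB; congr (_ *: _).
rewrite -(big_mkord xpredT (fun j => s x 0%N (i.+1 + j)%N - s x 0%N (i + j)%N)).
under eq_bigr do rewrite addSn -addnS.
by rewrite (telescope_sumr (fun j => s x 0%N (i + j)%N))// addn0 cocycle_sub.
Qed.

Lemma smoothed_dist N x i : (0 < N)%N ->
  `|smoothed N x i - s x 0%N i| <= E N (iter i tau x).
Proof.
move=> N0; have Nn0 : N%:R != 0 :> R by rewrite pnatr_eq0 -lt0n.
have -> : smoothed N x i - s x 0%N i =
    N%:R^-1 *: \sum_(j < N) s x i (i + j)%N.
  under [in RHS]eq_bigr do rewrite -cocycle_sub.
  rewrite sumrB scalerBr sumr_const card_ord; congr (_ - _).
  by rewrite -scalerMnr scalerMnl -[_^-1 *+ N]mulr_natl mulfV// scale1r.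
rewrite normrZ ger0_norm ?invr_ge0// ler_pdivrMl ?ltr0n//.
apply: le_trans (ler_norm_sum _ _ _) _.
apply: le_trans (ler_sum _ (G := fun=> E N (iter i tau x)) _) _.
  move=> j _; rewrite norm_cocycle_shift.
  by apply: le_trans (norm_cocycle_le _ _) _; apply: birkhoff_norm_nd; exact: ltnW.
by rewrite sumr_const card_ord mulr_natl.
Qed.

(** Telescoping the smoothed path uses blocks starting at every time. This yields a Birkhoff sum
    over [tau] itself rather than over its [N]-th iterate, which need not be ergodic. *)
Lemma norm_cocycle_block N x n : (0 < N)%N ->
  a n x <= E N x + E N (iter n tau x) +
    birkhoff_sum tau (fun y => N%:R^-1 * a N y) n x.
Proof.
move=> N0; have h i := smoothed_dist x i N0.
have hV : `|smoothed N x n - smoothed N x 0| <=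
    birkhoff_sum tau (fun y => N%:R^-1 * a N y) n x.
  elim: n => [|n IH]; first by rewrite subrr normr0 /birkhoff_sum big_ord0.
  rewrite /birkhoff_sum big_ord_recr /= addrC.
  rewrite -(subrK (smoothed N x n) (smoothed N x n.+1)) -addrA.
  apply: le_trans (ler_normD _ _) _; apply: lerD IH.
  by rewrite smoothed_step normrZ ger0_norm ?invr_ge0// norm_cocycle_shift.
have := h n; have := h 0%N; rewrite cocycle_diag subr0 /= => h0 hn.
have {1}-> : s x 0%N n = - (smoothed N x n - s x 0%N n) +
    (smoothed N x n - smoothed N x 0) + smoothed N x 0.
  by rewrite -addrA subrK opprB subrK.
have := ler_normD (- (smoothed N x n - s x 0%N n) +
   (smoothed N x n - smoothed N x 0)) (smoothed N x 0).
have := ler_normD (- (smoothed N x n - s x 0%N n)) (smoothed N x n - smoothed N x 0).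
rewrite normrN; lra.
Qed.

Lemma Rintegral_norm_ge0 n : 0 <= A n.
Proof. exact: Rintegral_ge0. Qed.

Lemma Rintegral_normD m n : A (m + n)%N <= A m + A n.
Proof.
rewrite -(RintegralT_iter mtau ptau m (s_int n)) -RintegralTD//; last first.
  exact: (Rintegrable_iter mtau ptau m (s_int n)).
apply: le_RintegralT => //; last by move=> x; exact: norm_cocycleD.
by apply: RintegrableD => //; exact: (Rintegrable_iter mtau ptau m (s_int n)).
Qed.

Variable L : R.
Hypothesis L_le : forall n, n%:R * L <= A n.
Hypothesis A_linear : linear_upper (fun n => A n) L.

Let avg_small e : 0 < e -> exists N, N.+1%:R^-1 * A N.+1 <= L + e.
Proof.
move=> /A_linear[N hN]; exists N.
by rewrite ler_pdivrMl ?ltr0n// hN.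
Qed.

Lemma kingman_upper : {ae mu, forall x, linear_upper (fun n => a n x) L}.
Proof.
have Ei N : Rintegrable mu (E N) by exact: Rintegrable_birkhoff_sum.
have ai N : Rintegrable mu (fun y => N%:R^-1 * a N y) by exact: RintegrableZ.
have H1 := ae_foralln (fun N => birkhoff_upper mtau ptau erg (Ei N)).
have H2 := ae_foralln (fun N => birkhoff_lower mtau ptau erg (Ei N)).
have H3 := ae_foralln (fun N => birkhoff_upper mtau ptau erg (ai N)).
apply: filterS3 H1 H2 H3 => x H1 H2 H3 e e0.
have e20 : 0 < e / 2 by rewrite divr_gt0.
have [N hN] := avg_small e20.
(* The boundary term is the difference of two consecutive Birkhoff sums of the same slope, hence
   sublinear. *)
have Eup : linear_upper (fun n => E N.+1 (iter n tau x)) 0.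
  have := linear_upperD (linear_upper_shift (H1 N.+1)) (H2 N.+1).
  rewrite subrr; apply: linear_upperW => n.
  by rewrite (birkhoff_sumSr _ (E N.+1) n x) addrAC subrr add0r.
have := linear_upperD (linear_upperD (linear_upper_cst (E N.+1 x)) Eup) (H3 N.+1).
rewrite !add0r RintegralTZ// => /(_ _ e20)[n0 hn0]; exists n0 => n n0n.
apply: le_trans (norm_cocycle_block x n (ltn0Sn N)) _.
apply: le_trans (hn0 _ n0n) _.
by rewrite ler_wpM2l//; apply: le_trans (lerD hN (lexx _)) _; lra.
Qed.

(** It bounds the amount by which a step of the smoothed path exceeds the rate [L]; its small
    integral is the [L^1] form of Kingman's upper bound. *)
Definition excess N x := Num.max (N%:R^-1 * a N x - L) 0.

Lemma Rintegrable_excess N : Rintegrable mu (excess N).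
Proof.
apply: Rintegrable_max; last exact: Rintegrable_cst.
by apply: RintegrableB; [exact: RintegrableZ|exact: Rintegrable_cst].
Qed.

Let L_ge0 : 0 <= L.
Proof.
rewrite leNgt; apply/negP => L0; have e0 : 0 < - L / 2 by lra.
have [N] := avg_small e0.
have : 0 <= N.+1%:R^-1 * A N.+1.
  by rewrite mulr_ge0 ?invr_ge0// Rintegral_norm_ge0.
by move=> /le_trans h /h; lra.
Qed.

(* With c = A 1 and G_N the Birkhoff average of the first norm, one has
   excess N <= min (excess N) c + G_N - min G_N c; the two minima are bounded
   and converge almost everywhere, to 0 and to c, while G_N has integral c. *)
Lemma excess_small (e : R) : 0 < e -> exists N, \int[mu]_x excess N.+1 x <= e.
Proof.
move=> e0; pose c := A 1%N; have c0 : 0 <= c := Rintegral_norm_ge0 1.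
pose G N x := N%:R^-1 * E N x.
have Gi N : Rintegrable mu (G N).
  by apply: RintegrableZ; exact: Rintegrable_birkhoff_sum.
have GI N : \int[mu]_x G N.+1 x = c.
  rewrite RintegralTZ; last exact: Rintegrable_birkhoff_sum.
  by rewrite RintegralT_birkhoff_sum// mulrA mulVf ?mul1r// pnatr_eq0.
have exG N x : 0 <= excess N x <= G N x.
  rewrite /excess le_max lexx orbT ge_max /G /=.
  have h0 : 0 <= N%:R^-1 * E N x by rewrite mulr_ge0 ?invr_ge0 ?birkhoff_norm_ge0.
  rewrite h0 andbT.
  have : N%:R^-1 * a N x <= N%:R^-1 * E N x.
    by rewrite ler_wpM2l ?invr_ge0 ?norm_cocycle_le.
  by move: L_ge0; lra.
pose D N x := Num.min (excess N x) c - Num.min (G N x) c.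
have Di N : Rintegrable mu (D N).
  apply: RintegrableB; apply: Rintegrable_min => //; try exact: Rintegrable_cst.
  exact: Rintegrable_excess.
have : (fun N => \int[mu]_x D N x) @ \oo --> \int[mu]_x (- c).
  apply: (@Rdominated_convergence _ _ _ _ _ _ (fun=> c)) => //.
  - by move=> N; exact: Rintegrable_measurable (Di N).
  - have H1 := birkhoff_upper mtau ptau erg (s_int 1).
    have H2 := birkhoff_lower mtau ptau erg (s_int 1).
    apply: filterS3 H1 H2 kingman_upper => x H1 H2 H3.
    have cvG : G ^~ x @ \oo --> c.
      have := linear_upper_cvg H1 H2; apply: cvg_trans; apply: near_eq_cvg.
      by apply: nearW => n; rewrite /G mulrC.
    have cvex : excess ^~ x @ \oo --> (0 : R).
      apply/cvgrPdist_le => eta eta0; have [N hN] := H3 _ eta0.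
      exists N.+1 => // n Nn; have {}Nn : (N < n)%N := Nn.
      rewrite sub0r normrN ger0_norm; last by have /andP[] := exG n x.
      rewrite /excess ge_max (ltW eta0) andbT lerBlDr addrC.
      rewrite ler_pdivrMl ?hN ?ltr0n//; first exact: ltnW.
      exact: leq_ltn_trans Nn.
    have -> : - c = Num.min 0 c - Num.min c c by rewrite (min_l c0) minxx sub0r.
    by apply: cvgB; exact: cvg_min_cst.
  - exact: Rintegrable_cst.
  - move=> N x; have /andP[h1 h2] := exG N x; rewrite /D ler_norml.
    by case: (leP (excess N x) c); case: (leP (G N x) c); lra.
rewrite RintegralT_cst => /cvgrPdist_le /(_ e e0) [N _ hN].
exists N; have := hN N.+1 (leqnSn N); rewrite ler_norml => /andP[h1 h2].
have : \int[mu]_x excess N.+1 x <= \int[mu]_x (D N.+1 x + G N.+1 x).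
  apply: le_RintegralT => [||x]; first exact: Rintegrable_excess.
    exact: RintegrableD.
  have /andP[h3 h4] := exG N.+1 x; rewrite /D.
  by case: (leP (excess N.+1 x) c); case: (leP (G N.+1 x) c); lra.
rewrite RintegralTD// GI; lra.
Qed.

End SubadditiveCocycle.

(** * Weak* compact sets of functionals *)

Section DualElements.
Context {R : realType} {B : normedModType R}.
Implicit Types (phi : B -> R) (u v : B).

Definition dual_ball phi := is_dual phi /\ forall b, `|phi b| <= `|b|.

Lemma dual_ball0 phi : dual_ball phi -> phi 0 = 0.
Proof. by move=> [[lin _] _]; have := lin 1 0 0; rewrite scaler0 addr0; lra. Qed.

Lemma dual_ballD phi u v : dual_ball phi -> phi (u + v) = phi u + phi v.
Proof. by move=> [[lin _] _]; have := lin 1 u v; rewrite scale1r mul1r. Qed.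

Lemma dual_ballZ phi a u : dual_ball phi -> phi (a *: u) = a * phi u.
Proof.
by move=> phiB; have [[lin _] _] := phiB; have := lin a u 0; rewrite addr0 (dual_ball0 phiB) addr0.
Qed.

Lemma dual_ballN phi u : dual_ball phi -> phi (- u) = - phi u.
Proof. by move=> phiB; rewrite -scaleN1r dual_ballZ// mulN1r. Qed.

Lemma dual_ballB phi u v : dual_ball phi -> phi (u - v) = phi u - phi v.
Proof. by move=> phiB; rewrite dual_ballD// dual_ballN. Qed.

Lemma dual_ball_le phi u : dual_ball phi -> phi u <= `|u|.
Proof. by move=> [_ h]; rewrite (le_trans (ler_norm _)). Qed.

Lemma dual_ball_lip phi u v : dual_ball phi -> `|phi u - phi v| <= `|u - v|.
Proof. by move=> phiB; rewrite -dual_ballB//; case: phiB. Qed.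

Lemma separable_dense_seq : separable_space B ->
  exists b : nat -> B, forall y e, 0 < e -> exists i, `|y - b i| < e.
Proof.
move=> [D [cD clD]].
have [D0|[f]] := pfcard_geP cD.
  have : closure D (0 : B) by rewrite clD.
  by rewrite D0 closure0.
exists f => y e e0.
have : closure D y by rewrite clD.
move=> /(_ (ball y e) (nbhsx_ballx _ _ e0)) [z [Dz]].
have [i _ <-] := 'surj_f Dz.
by rewrite -ball_normE /= => h; exists i.
Qed.

End DualElements.

Section WeakStarCompact.
Context {R : realType} {B : normedModType R} (C : set (B -> R)).
Hypothesis Cball : C `<=` dual_ball.
Hypothesis Ccompact : compact (C : set {ptws B -> R}).

(** Weak* compactness gives a cluster point, which serves in place of a convergent subsequence:
    eventual lower bounds for the values at a point pass to it. *)
Lemma compact_seq_cluster (phi_ : nat -> B -> R) : (forall n, C (phi_ n)) ->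
  exists2 phi, C phi & forall y r,
    (forall e, 0 < e -> exists N, forall n, (N <= n)%N -> r - e <= phi_ n y) ->
    r <= phi y.
Proof.
move=> Cphi.
have FC : ((phi_ : nat -> {ptws B -> R}) @ \oo) (C : set {ptws B -> R}).
  by exists 0%N => // n _; exact: Cphi.
have [phi [Cp clp]] := Ccompact _ FC.
exists phi => // y r h; rewrite leNgt; apply/negP => lt_phi.
have e0 : 0 < (r - phi y) / 2 by rewrite divr_gt0// subr_gt0.
have [N hN] := h _ e0.
have [||psi []] := clp [set psi : {ptws B -> R} | r - (r - phi y) / 2 <= psi y]
    [set psi : {ptws B -> R} | psi y < r - (r - phi y) / 2].
- by exists N => // n; exact: hN.
- have cy := @proj_continuous B (fun=> R) y phi.
  apply: (cy [set z : R | z < r - (r - phi y) / 2]).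
  by apply: open_nbhs_nbhs; split; [exact: open_lt|rewrite /proj /=; lra].
- by rewrite /= => h1 h2; have := le_lt_trans h1 h2; rewrite ltxx.
Qed.

Hypothesis Bsep : separable_space B.
Hypothesis C0 : C !=set0.

(** For each scale and each finite list of integers, a member of [C] is picked whose values at the
    dense points [b j] match the list on that scale. These countably many members are pointwise
    dense in [C], because elements of the dual ball are 1-Lipschitz. *)
Lemma compact_dense_seq : exists D : nat -> B -> R, (forall i, C (D i)) /\
  forall phi, C phi -> forall m (y : nat -> B) e, 0 < e ->
    exists i, forall j, (j < m)%N -> `|D i (y j) - phi (y j)| < e.
Proof.
have [b hb] := separable_dense_seq Bsep; have [phi0 Cphi0] := C0.
pose N (w : nat * seq int) := [set phi | C phi /\ forall j, (j < size w.2)%N ->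
  `|phi (b j) - (nth 0 w.2 j)%:~R / w.1.+1%:R| <= w.1.+1%:R^-1].
(* The default [phi0] covers numbers that code nothing and patterns that no member of [C]
   matches. *)
pose D i := if pickle_inv (i : nat) is Some w then xget phi0 (N w) else phi0.
have CD i : C (D i).
  rewrite /D; case: pickle_inv => // w.
  by case: xgetP => [phi _ []|].
exists D; split=> // phi Cphi m y e e0.
have e40 : 0 < e / 4 by rewrite divr_gt0.
have /choice[k hk] : forall j, exists i, `|y j - b i| < e / 8.
  by move=> j; apply: hb; rewrite divr_gt0.
pose M := \max_(j < m) (k j).+1.
have kM j : (j < m)%N -> (k j < M)%N.
  by move=> jm; rewrite /M (bigD1 (Ordinal jm))//= leq_max leqnn.
have [p hp] : exists p : nat, p.+1%:R^-1 <= e / 8 by apply: invS_le; rewrite divr_gt0.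
(* The pattern of [phi] itself: the chosen member matches it too, and four errors of at most [e / 8]
   remain. *)
pose w : nat * seq int := (p, mkseq (fun j => Num.floor (phi (b j) * p.+1%:R)) M).
have p0 : 0 < p.+1%:R :> R by rewrite ltr0n.
have Nphi : N w phi.
  split => // j; rewrite /w /= size_mkseq => jM; rewrite nth_mkseq//.
  have /andP[] := floor_itv (phi (b j) * p.+1%:R); rewrite intrD.
  set z : R := (Num.floor _)%:~R; set q := p.+1%:R in p0 * => z1 z2.
  have zB : z / q - q^-1 = (z - 1) / q by rewrite mulrBl mul1r.
  have zD : z / q + q^-1 = (z + 1) / q by rewrite mulrDl mul1r.
  rewrite ler_distl zB zD ler_pdivrMr// ler_pdivlMr//; apply/andP; split; lra.
exists (pickle w) => j jm; rewrite /D pickleK_inv.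
have [Cpsi] : N w (xget phi0 (N w)) by apply: xgetPex; exists phi.
set psi := xget _ _ in Cpsi *.
case: Nphi => _ /(_ (k j)) h1 /(_ (k j)) h2.
move: h1 h2; rewrite /w /= size_mkseq => /(_ (kM _ jm)) h1 /(_ (kM _ jm)) h2.
have h3 := dual_ball_lip (y j) (b (k j)) (Cball Cphi).
have h4 := dual_ball_lip (y j) (b (k j)) (Cball Cpsi).
have h5 := hk j.
move: h1 h2 h3 h4; rewrite !ler_norml ltr_norml.
move: (p.+1%:R^-1) hp => q hp.
move=> /andP[? ?] /andP[? ?] /andP[? ?] /andP[? ?].
by apply/andP; split; lra.
Qed.

End WeakStarCompact.

(** * Measurable selection of constrained functionals *)

Lemma measurable_fun_sublevel {R : realType} {d : measure_display} {X : measurableType d}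
    (f : X -> R) :
  (forall t, measurable [set x | f x <= t]) -> measurable_fun setT f.
Proof.
move=> mf _; apply: (measurability _ (RGenOInfty.measurableE R)) => //.
move=> /= _ [_ [t ->] <-]; rewrite setTI.
rewrite (_ : _ @^-1` _ = ~` [set x | f x <= t]); first exact: measurableC.
by apply/seteqP; split => x /=; rewrite in_itv /= andbT ltNge => /negP.
Qed.

Lemma measurable_ltr {R : realType} {d : measure_display} {X : measurableType d}
    (f g : X -> R) : measurable_fun setT f -> measurable_fun setT g ->
  measurable [set x | f x < g x].
Proof.
move=> mf mg; have mgf := measurable_funB mg mf.
rewrite (_ : [set x | _] = (g \- f) @^-1` `]0, +oo[).
  by rewrite -[X in measurable X]setTI; exact: mgf.
by apply/seteqP; split => x /=; rewrite in_itv /= andbT subr_gt0.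
Qed.

Section Selection.
Context {R : realType} {d : measure_display} {X : measurableType d}.
Context {B : normedModType R} (C : set (B -> R)).
Hypothesis Cball : C `<=` dual_ball.
Hypothesis Ccompact : compact (C : set {ptws B -> R}).
Hypothesis Bsep : separable_space B.
Hypothesis C0 : C !=set0.

(** A countable system of lower bounds on functionals, given by vectors and thresholds depending on
    [x]. Upper bounds enter by negating both. *)
Definition constraints := ((nat -> X -> B) * (nat -> X -> R))%type.

Definition measurable_constraints (K : constraints) :=
  (forall i phi, C phi -> measurable_fun setT (fun x => phi (K.1 i x))) /\
  forall i, measurable_fun setT (K.2 i).

Definition feasible (K : constraints) x :=
  [set phi | C phi /\ forall i, K.2 i x <= phi (K.1 i x)].

(** By compactness, a feasible functional exists exactly when for every [m] some member of a
    countable dense family meets the first [m] constraints up to [1/(m+1)]. *)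
Lemma measurable_feasible K : measurable_constraints K ->
  measurable [set x | feasible K x !=set0].
Proof.
move=> [mK1 mK2].
have [D [CD hD]] := compact_dense_seq Cball Bsep C0.
pose S m k i := [set x | (i < m)%N -> K.2 i x - m.+1%:R^-1 < D k (K.1 i x)].
rewrite (_ : [set x | _] = \bigcap_m \bigcup_k \bigcap_i S m k i).
  apply: bigcapT_measurable => m; apply: bigcupT_measurable => k.
  apply: bigcapT_measurable => i; rewrite /S.
  case: (ltnP i m) => im; last first.
    by rewrite (_ : [set x | _] = setT)//; apply/seteqP; split.
  rewrite (_ : [set x | _] = [set x | K.2 i x - m.+1%:R^-1 < D k (K.1 i x)]).
    apply: measurable_ltr; last exact: mK1.
    by apply: measurable_funB => //; exact: measurable_cst.
  by apply/seteqP; split => x /=; [apply|].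
apply/seteqP; split => x.
  move=> [phi [Cphi hphi]] m _.
  have e0 : 0 < m.+1%:R^-1 :> R by rewrite invr_gt0.
  have [k hk] := hD _ Cphi m (K.1 ^~ x) _ e0.
  exists k => // i _ im; have := hk i im; have := hphi i.
  rewrite ltr_distl; move: (m.+1%:R^-1) => q h1 /andP[h2 h3]; lra.
move=> hx.
have /choice[k hk] : forall m, exists k, forall i, S m k i x.
  by move=> m; have [k _ hk] := hx m I; exists k => i; exact: hk.
have [phi Cphi hphi] := compact_seq_cluster Ccompact (fun m => CD (k m)).
exists phi; split => // i; apply: hphi => e e0.
have [p hp] := invS_le e0.
exists (maxn i.+1 p) => m; rewrite geq_max => /andP[im pm].
have := hk m i im; have : m.+1%:R^-1 <= p.+1%:R^-1 :> R.
  by rewrite lef_pV2 ?posrE ?ltr0n// ler_nat.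
move: (m.+1%:R^-1) (p.+1%:R^-1) hp => q q' h1 h2 h3; lra.
Qed.

Definition add_constraint (y : X -> B) (r : X -> R) (K : constraints) : constraints :=
  (fun i => if i is i'.+1 then K.1 i' else y,
   fun i => if i is i'.+1 then K.2 i' else r).

Lemma feasible_add y r K x phi : feasible (add_constraint y r K) x phi <->
  feasible K x phi /\ r x <= phi (y x).
Proof.
split => [[Cphi h]|[[Cphi h] hr]].
  by split; [split => // i; exact: (h i.+1)|exact: (h 0%N)].
by split => // -[|i] /=.
Qed.

Lemma measurable_add_constraint y r K : measurable_constraints K ->
  (forall phi, C phi -> measurable_fun setT (fun x => phi (y x))) ->
  measurable_fun setT r -> measurable_constraints (add_constraint y r K).
Proof. by move=> [mK1 mK2] my mr; split; case=> [|i] //=; exact: mK1. Qed.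

Definition feasible_min (K : constraints) (b : B) x :=
  inf [set phi b | phi in feasible K x].

Lemma feasible_min_le K b x phi : feasible K x phi -> feasible_min K b x <= phi b.
Proof.
move=> Kphi; apply: ge_inf; last by exists phi.
exists (- `|b|) => _ [psi [Cpsi _] <-].
by have := (Cball Cpsi).2 b; rewrite ler_norml => /andP[].
Qed.

Lemma feasible_min_attained K b x : feasible K x !=set0 ->
  exists2 phi, feasible K x phi & phi b = feasible_min K b x.
Proof.
move=> K0.
have inf0 : [set phi b | phi in feasible K x] !=set0.
  by have [phi Kphi] := K0; exists (phi b); exists phi.
have hinf : has_inf [set phi b | phi in feasible K x].
  split => //; exists (- `|b|) => _ [psi [Cpsi _] <-].
  by have := (Cball Cpsi).2 b; rewrite ler_norml => /andP[].
have /choice[phi_ hphi_] : forall n : nat, exists phi, feasible K x phi /\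
    phi b < feasible_min K b x + n.+1%:R^-1.
  move=> n; have e0 : 0 < n.+1%:R^-1 :> R by rewrite invr_gt0.
  by have [_ [phi Kphi <-] hlt] := inf_adherent e0 hinf; exists phi.
have [phi Cphi hphi] := compact_seq_cluster Ccompact (fun n => (hphi_ n).1.1).
have Kphi : feasible K x phi.
  split => // i; apply: hphi => e e0; exists 0%N => n _.
  by have := (hphi_ n).1.2 i; lra.
exists phi => //; apply/eqP; rewrite eq_le feasible_min_le// andbT.
(* The upper bound at [b] becomes a lower bound at [- b], the form that passes to a cluster
   point. *)
rewrite -lerN2 -(dual_ballN b (Cball Cphi)).
apply: hphi => e e0; have [p hp] := invS_le e0; exists p => m pm.
rewrite dual_ballN; last by apply: Cball; exact: (hphi_ m).1.1.
have := (hphi_ m).2; have : m.+1%:R^-1 <= p.+1%:R^-1 :> R.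
  by rewrite lef_pV2 ?posrE ?ltr0n// ler_nat.
move: (m.+1%:R^-1) (p.+1%:R^-1) hp => q q' h1 h2 h3; lra.
Qed.

(** Since the minimum is attained, it is at most [t] exactly where the system stays feasible with
    the upper bound [t] at [b] added. *)
Lemma measurable_feasible_min K b : measurable_constraints K ->
  (forall x, feasible K x !=set0) -> measurable_fun setT (feasible_min K b).
Proof.
move=> mK K0; apply: measurable_fun_sublevel => t.
rewrite (_ : [set x | _] =
    [set x | feasible (add_constraint (fun=> - b) (fun=> - t) K) x !=set0]).
  by apply: measurable_feasible; exact: measurable_add_constraint.
apply/seteqP; split => x /=.
  move=> mint; have [phi Kphi phib] := feasible_min_attained b (K0 x).
  exists phi; apply/feasible_add; split => //.
  by rewrite dual_ballN ?lerN2 ?phib//; apply: Cball; case: Kphi.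
move=> [phi /feasible_add[Kphi]].
rewrite dual_ballN ?lerN2; last by apply: Cball; case: Kphi.
exact: le_trans (feasible_min_le _ Kphi).
Qed.

(* Minimizing successively at the points of a dense sequence leaves exactly one
   functional over each x, and its values at those points are measurable in x. *)
Lemma measurable_selection K : measurable_constraints K ->
  (forall x, feasible K x !=set0) ->
  exists xi : X -> B -> R, (forall x, feasible K x (xi x)) /\
    forall b, measurable_fun setT (fun x => xi x b).
Proof.
move=> mK K0; have [b hb] := separable_dense_seq Bsep.
pose next n K := add_constraint (fun=> - b n) (fun x => - feasible_min K (b n) x) K.
pose Ks := fix Ks n := if n is n'.+1 then next n' (Ks n') else K.
have nextE n K' x phi : feasible (next n K') x phi <->
    feasible K' x phi /\ phi (b n) <= feasible_min K' (b n) x.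
  rewrite /next; split => [/feasible_add[Kphi]|[Kphi h]].
    by rewrite dual_ballN ?lerN2//; apply: Cball; case: Kphi.
  by apply/feasible_add; split => //; rewrite dual_ballN ?lerN2//; apply: Cball; case: Kphi.
have [mKs Ks0] : (forall n, measurable_constraints (Ks n)) /\
    (forall n x, feasible (Ks n) x !=set0).
  apply: all_and2 => n; elim: n => [//|n [mKn Kn0]]; split.
    apply: measurable_add_constraint => //.
    by apply: measurableT_comp => //; exact: measurable_feasible_min.
  move=> x; have [phi Kphi phib] := feasible_min_attained (b n) (Kn0 x).
  by exists phi; apply/nextE; rewrite phib.
have Ks_nd x phi m n : (m <= n)%N -> feasible (Ks n) x phi -> feasible (Ks m) x phi.
  move=> /subnK <-; elim: (n - m)%N => [//|k IH].
  by rewrite addSn => /nextE[/IH].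
(* The systems are nested, so a cluster point of functionals feasible at the successive stages
   satisfies all of them. *)
have /choice[xi hxi] : forall x, exists phi, forall n, feasible (Ks n) x phi.
  move=> x; have /choice[phi_ hphi_] := Ks0 ^~ x.
  have [phi Cphi hphi] := compact_seq_cluster Ccompact (fun n => (hphi_ n).1).
  exists phi => m; split => // i; apply: hphi => e e0; exists m => n mn.
  by have [_ /(_ i)] := Ks_nd _ _ _ _ mn (hphi_ n); lra.
exists xi; split => [x|y]; first exact: (hxi x 0%N).
have mxib n : measurable_fun setT (fun x => xi x (b n)).
  rewrite (_ : (fun x => _) = feasible_min (Ks n) (b n)).
    exact: measurable_feasible_min.
  apply/funext => x; apply/eqP; rewrite eq_le feasible_min_le// andbT.
  by have /nextE[] := hxi x n.+1.
have /choice[k hk] : forall j : nat, exists i, `|y - b i| < j.+1%:R^-1.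
  by move=> j; apply: hb; rewrite invr_gt0.
apply: (measurable_fun_cvg (fun j => mxib (k j))) => x _.
apply/cvgrPdist_le => e e0; have [p hp] := invS_le e0.
exists p => // j pj; have {}pj : (p <= j)%N := pj.
have CB : dual_ball (xi x) by apply: Cball; case: (hxi x 0%N).
apply: le_trans (dual_ball_lip _ _ CB) _; apply: le_trans (ltW (hk j)) _.
by apply: le_trans hp; rewrite lef_pV2 ?posrE ?ltr0n// ler_nat.
Qed.

(** Multiplying the constraints by the indicator of the feasible set leaves them unchanged there and
    turns them into [0 <= phi 0] elsewhere, so a selection exists over the whole space. *)
Lemma partial_measurable_selection K : measurable_constraints K ->
  exists xi : X -> B -> R, [/\ forall x, C (xi x),
    forall x, feasible K x !=set0 -> feasible K x (xi x) &
    forall b, measurable_fun setT (fun x => xi x b)].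
Proof.
move=> mK; pose E := [set x | feasible K x !=set0].
have mE : measurable E by exact: measurable_feasible.
pose K' : constraints :=
  (fun i x => (\1_E x : R) *: K.1 i x, fun i x => \1_E x * K.2 i x).
have mK' : measurable_constraints K'.
  split=> [i phi Cphi|i]; last first.
    by apply: measurable_funM; [exact: measurable_indic|exact: mK.2].
  rewrite (_ : (fun x => _) = (\1_E \* (fun x => phi (K.1 i x)))).
    by apply: measurable_funM; [exact: measurable_indic|exact: mK.1].
  by apply/funext => x /=; rewrite dual_ballZ//; exact: Cball.
have K'E x : E x -> feasible K' x = feasible K x.
  move=> Ex; apply/seteqP; split => phi [Cphi h]; split => // i; have := h i;
  by rewrite /K' /= indicE mem_set// mul1r scale1r.
have K'0 x : feasible K' x !=set0.
  have [Ex|nEx] := pselect (E x); first by rewrite K'E.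
  have [phi Cphi] := C0; exists phi; split => // i.
  by rewrite /K' /= indicE memNset// mul0r scale0r (dual_ball0 (Cball Cphi)).
have [xi [hxi mxi]] := measurable_selection mK' K'0.
exists xi; split => // x; first by case: (hxi x).
by move=> Ex; rewrite -K'E.
Qed.

End Selection.

(** * Construction of the functionals *)

(* Backward induction on the time: a bad step is crossed in one jump, whose
   endpoints absorb the two error terms, a good step is crossed one unit at a
   time. *)
Lemma count_bad_times {R : realType} (n : nat) (v f w : nat -> R) (L e : R) (bad : pred nat) :
  0 <= e -> (forall i, 0 <= f i) -> (forall i, 0 <= w i) ->
  (forall i, (i < n)%N -> v i.+1 - v i <= L + f i) ->
  (forall k, (k < n)%N -> bad k -> exists l, [/\ (0 < l)%N, (k + l <= n)%N &
     v (k + l)%N - v k <= (L - e) * l%:R + w k + w (k + l)%N]) ->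
  e * \sum_(k < n) (bad k)%:R <=
    n%:R * L - (v n - v 0%N) + \sum_(k < n) f k + 2 * \sum_(k < n.+1) w k.
Proof.
move=> e0 f0 w0 hv hbad.
(* The weight at the starting time [k] is counted once and later ones twice: a time may end one jump
   and begin the next. *)
suff H m k : (k + m = n)%N -> e * \sum_(k <= i < n) (bad i)%:R <=
    m%:R * L - (v n - v k) + \sum_(k <= i < n) f i + w k +
    2 * \sum_(k.+1 <= i < n.+1) w i.
  have := H n 0%N (add0n n).
  rewrite -(big_mkord xpredT (fun k => (bad k)%:R)) -(big_mkord xpredT f).
  rewrite -(big_mkord xpredT w) [in X in _ -> X](big_ltn (F := w))//.
  by have := w0 0%N; lra.
elim/ltn_ind: m k => m IH k kmn.
case: m IH kmn => [|m] IH kmn.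
  have -> : k = n by lia.
  by rewrite !big_geq// mulr0 mul0r subrr oppr0 !add0r mulr0 addr0.
have kn : (k < n)%N by lia.
have [bk|nbk] := boolP (bad k); last first.
  rewrite big_ltn// (negbTE nbk) add0r (big_ltn (F := f))//.
  rewrite (big_ltn (F := w))//.
  have := IH m (ltnSn m) k.+1 ltac:(lia); have := hv k kn.
  have := w0 k; have := w0 k.+1; rewrite -(natr1 m); lra.
have [l [l0 kln hl]] := hbad k kn bk.
have lm : (m.+1 - l < m.+1)%N by lia.
have IHl := IH _ lm (k + l)%N ltac:(lia).
have mE : m.+1%:R = (m.+1 - l)%:R + l%:R :> R by rewrite -natrD subnK//; lia.
rewrite (big_cat_nat (n := (k + l)%N)) ?leq_addr//=.
rewrite (big_cat_nat (n := (k + l)%N) (F := f)) ?leq_addr//=.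
rewrite (big_cat_nat (n := (k + l).+1) (F := w)) ?ltnS ?leq_addr//=.
have kl : (k < k + l)%N by rewrite -{1}(addn0 k) ltn_add2l.
rewrite (@big_nat_recr _ _ _ (k + l)%N k.+1 w kl)/=.
have : \sum_(k <= i < k + l) (bad i)%:R <= l%:R :> R.
  apply: le_trans (ler_sum_nat (G := fun=> 1) _) _.
    by move=> i _; rewrite lern1 leq_b1.
  by rewrite sumr_const_nat addKn.
have : 0 <= \sum_(k <= i < k + l) f i by exact: sumr_ge0.
have : 0 <= \sum_(k.+1 <= i < k + l) w i by exact: sumr_ge0.
rewrite mE; set S1 := \sum_(k <= i < k + l) (bad i)%:R.
move=> h1 h2 h3.
have h4 : e * S1 <= e * l%:R by rewrite ler_wpM2l.
have := w0 k; lra.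
Qed.

Section Rays.
Context {R : realType} {d : measure_display} {X : measurableType d}.
Variables (mu : probability X R) (tau : X -> X).
Hypothesis mtau : measurable_fun setT tau.
Hypothesis ptau : forall A, measurable A -> mu (tau @^-1` A) = mu A.
Hypothesis erg : forall A, measurable A -> tau @^-1` A = A ->
  mu A = 0%E \/ mu A = 1%E.
Context {B : normedModType R} (s : X -> nat -> nat -> B).
Hypothesis sD : forall x m l n, s x m l + s x l n = s x m n.
Hypothesis s_shift : forall k x m n,
  `|s (iter k tau x) m n| = `|s x (m + k)%N (n + k)%N|.
Hypothesis s_int : forall n, Rintegrable mu (fun x => `|s x 0%N n|).
Context (C : set (B -> R)).
Hypothesis Cball : C `<=` dual_ball.
Hypothesis Ccompact : compact (C : set {ptws B -> R}).
Hypothesis Bsep : separable_space B.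
Hypothesis C0 : C !=set0.
Hypothesis C_shift : forall k x phi, C phi -> exists2 psi, C psi &
  forall m n, psi (s (iter k tau x) m n) = phi (s x (m + k)%N (n + k)%N).
Hypothesis s_meas : forall n phi, C phi ->
  measurable_fun setT (fun x => phi (s x 0%N n)).
Hypothesis s_norming : forall n, (0 < n)%N -> {ae mu, forall x, exists2 phi, C phi &
  `|s x 0%N n| - 1 <= phi (s x 0%N n)}.
Variable L : R.
Hypothesis L_le : forall n, n%:R * L <= \int[mu]_x `|s x 0%N n|.
Hypothesis A_linear : linear_upper (fun n => \int[mu]_x `|s x 0%N n|) L.

Local Notation a n x := `|s x 0%N n|.
Local Notation A n := (\int[mu]_x a n x).
Local Notation E N := (birkhoff_sum tau (fun x => a 1%N x) N).

(** The length [l] runs over a finite type, so that badness is a boolean and bad times can be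
    counted by a sum. *)
Definition bad_time (K : nat) (e : R) n x (phi : B -> R) k :=
  [exists l : 'I_n.+1, [&& (K <= l)%N, (k + l <= n)%N &
    phi (s x k (k + l)%N) < (L - e) * l%:R]].

(** [count_bad_times] is applied to the values of [phi] on the smoothed path, with [e / 2] for [e].
    The majorant [H] does not depend on [phi], so it can be integrated although the norming
    functional is chosen without regard to measurability. *)
Lemma bad_times_bound (e rho : R) : 0 < e -> 0 < rho -> exists K (c : R), forall n,
  exists H : X -> R, [/\ Rintegrable mu H, \int[mu]_x H x <= n%:R * rho + c &
    forall x phi, C phi -> a n x - 1 <= phi (s x 0%N n) ->
      \sum_(k < n) (bad_time K e n x phi k)%:R <= H x].
Proof.
move=> e0 rho0; pose e2 := e / 2; have e20 : 0 < e2 by rewrite divr_gt0.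
have eta0 : 0 < e2 * rho / 2 by rewrite divr_gt0// mulr_gt0.
have eta'0 : 0 < e2 * rho / 4 by rewrite divr_gt0// mulr_gt0.
have [N' hN] := excess_small mtau ptau erg sD s_shift s_int A_linear eta0.
set N := N'.+1 in hN.
have Ei : Rintegrable mu (E N) by exact: Rintegrable_birkhoff_sum.
have [M hM] := tail_small Ei (birkhoff_norm_ge0 tau s N) eta'0.
pose w x := Num.max (E N x - M%:R) 0.
have wi : Rintegrable mu w.
  by apply: Rintegrable_max; [apply: RintegrableB|]; try exact: Rintegrable_cst.
(* On intervals longer than [K], the part of the boundary errors below [M] costs at most [e / 2] of
   the rate; the part above [M] is left to [w]. *)
have [K hK] := nat_archi (2 * M%:R / e2).
have exi : Rintegrable mu (excess s L N) by exact: Rintegrable_excess.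
(* The three terms come from the norming defect 1, the smoothing errors at both ends, and the extra
   last term in the sum of [w]. *)
exists K.+1, (e2^-1 * (1 + 2 * \int[mu]_x E N x + e2 * rho / 2)) => n.
pose H0 x := (n%:R * L + 1) - a n x + (E N x + E N (iter n tau x)) +
  (birkhoff_sum tau (excess s L N) n x + 2 * birkhoff_sum tau w n.+1 x).
have i1 : Rintegrable mu (fun x => (n%:R * L + 1) - a n x).
  by apply: RintegrableB; [exact: Rintegrable_cst|exact: s_int].
have i2' : Rintegrable mu (fun x => E N (iter n tau x)).
  exact: Rintegrable_iter.
have i2 : Rintegrable mu (fun x => E N x + E N (iter n tau x)) by exact: RintegrableD.
have i3 : Rintegrable mu (birkhoff_sum tau (excess s L N) n).
  exact: Rintegrable_birkhoff_sum.
have i4' : Rintegrable mu (birkhoff_sum tau w n.+1) by exact: Rintegrable_birkhoff_sum.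
have i4 : Rintegrable mu (fun x => 2 * birkhoff_sum tau w n.+1 x) by exact: RintegrableZ.
have i12 := RintegrableD i1 i2; have i34 := RintegrableD i3 i4.
have H0i : Rintegrable mu H0 by exact: RintegrableD.
exists (fun x => e2^-1 * H0 x); split; first exact: RintegrableZ.
  have I1 : \int[mu]_x ((n%:R * L + 1) - a n x) = n%:R * L + 1 - A n.
    by rewrite RintegralTB ?RintegralT_cst//; exact: Rintegrable_cst.
  have I2 : \int[mu]_x (E N x + E N (iter n tau x)) = 2 * \int[mu]_x E N x.
    by rewrite RintegralTD// (RintegralT_iter mtau ptau n Ei); lra.
  have I3 := RintegralT_birkhoff_sum mtau ptau n exi.
  have I4 : \int[mu]_x (2 * birkhoff_sum tau w n.+1 x) = 2 * (n.+1%:R * \int[mu]_x w x).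
    by rewrite RintegralTZ// (RintegralT_birkhoff_sum mtau ptau n.+1 wi).
  rewrite RintegralTZ// ler_pdivrMl// (RintegralTD i12 i34).
  rewrite (RintegralTD i1 i2) (RintegralTD i3 i4) I1 I2 I3 I4.
  have h1 : n%:R * \int[mu]_x excess s L N x <= n%:R * (e2 * rho / 2).
    by rewrite ler_wpM2l.
  have h2 : n.+1%:R * \int[mu]_x w x <= n.+1%:R * (e2 * rho / 4).
    by rewrite ler_wpM2l.
  (* The main term [n * L - A n] is at most 0. *)
  have h3 := L_le n.
  rewrite mulrDr (mulrA e2 e2^-1) mulfV ?gt_eqF// mul1r.
  move: h1 h2; rewrite -(natr1 n); lra.
move=> x phi Cphi hphi; have phiB := Cball Cphi.
rewrite ler_pdivlMl//.
pose v i := phi (smoothed s N x i).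
have vs i : `|v i - phi (s x 0%N i)| <= E N (iter i tau x).
  apply: le_trans (dual_ball_lip _ _ phiB) _.
  exact: smoothed_dist.
have E0 i : 0 <= E N (iter i tau x) by exact: birkhoff_norm_ge0.
have := @count_bad_times R n v (fun i => excess s L N (iter i tau x))
  (fun i => w (iter i tau x)) L e2 (bad_time K.+1 e n x phi) (ltW e20).
have Nn0 : N%:R^-1 * N%:R = 1 :> R by rewrite mulVf ?pnatr_eq0.
move=> /(_ _ _ _ _)/le_trans; apply.
- by move=> i; rewrite /excess le_max lexx orbT.
- by move=> i; rewrite /w le_max lexx orbT.
- move=> i _; rewrite /v -dual_ballB// smoothed_step// dual_ballZ//.
  have h : N%:R^-1 * phi (s x i (i + N)%N) <= N%:R^-1 * a N (iter i tau x).
    rewrite ler_wpM2l ?invr_ge0// -(norm_cocycle_shift s_shift).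
    exact: dual_ball_le.
  apply: le_trans h _; rewrite /excess -lerBlDl le_max lexx //.
- move=> k kn /existsP[l /and3P[Kl kln hl]]; exists l; split => //.
    exact: leq_ltn_trans Kl.
  have h1 := vs k; have h2 := vs (k + l)%N.
  have w1 : E N (iter k tau x) <= M%:R + w (iter k tau x).
    by rewrite /w -lerBlDl le_max lexx.
  have w2 : E N (iter (k + l) tau x) <= M%:R + w (iter (k + l) tau x).
    by rewrite /w -lerBlDl le_max lexx.
  have h3 : 2 * M%:R <= e2 * l%:R.
    by rewrite [leRHS]mulrC -ler_pdivrMr// (le_trans hK)// ler_nat ltnW.
  have h4 : phi (s x k (k + l)%N) = phi (s x 0%N (k + l)%N) - phi (s x 0%N k).
    by rewrite -dual_ballB// cocycle_sub.
  move: h1 h2 hl; rewrite h4 !ler_norml /e2 => /andP[? ?] /andP[? ?] hl.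
  rewrite /e2 in h3; lra.
(* At the two ends, [v n - v 0] is compared with [phi (s x 0 n)], which is at least [a n x - 1]. *)
have h1 := vs 0%N; have h2 := vs n; move: h1 h2.
rewrite (cocycle_diag sD) (dual_ball0 phiB) subr0 !ler_norml => /andP[h1 h2] /andP[h3 h4].
by rewrite /H0; move: h1 h2 h3 h4; rewrite /birkhoff_sum /=; lra.
Qed.

(** * Points carrying functionals of full growth *)

Definition pair_index (i : nat) : nat * nat := odflt (0, 0)%N (pickle_inv i).

Lemma pair_indexK j l : pair_index (pickle (j, l)) = (j, l).
Proof. by rewrite /pair_index pickleK_inv. Qed.

(** Pair [(j, l)] demands growth rate at least [L - 1/(j+1)] up to time [l]. Pairs outside [P]
    receive the trivial constraint [0 <= phi 0]. *)
Definition ray_constraints (P : nat -> nat -> bool) : constraints (X := X) (B := B) :=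
  (fun i x => if P (pair_index i).1 (pair_index i).2
     then s x 0%N (pair_index i).2 else 0,
   fun i _ => if P (pair_index i).1 (pair_index i).2
     then (L - (pair_index i).1.+1%:R^-1) * (pair_index i).2%:R else 0).

Lemma feasible_rayP P x phi : feasible C (ray_constraints P) x phi <->
  C phi /\ forall j l, P j l -> (L - j.+1%:R^-1) * l%:R <= phi (s x 0%N l).
Proof.
split => [[Cphi h]|[Cphi h]]; split => //.
  by move=> j l Pjl; have := h (pickle (j, l)); rewrite /= pair_indexK /= Pjl.
move=> i /=; case: ifPn => [|_]; first exact: h.
by rewrite (dual_ball0 (Cball Cphi)).
Qed.

Lemma measurable_ray_constraints P : measurable_constraints C (ray_constraints P).
Proof.
split=> [i phi Cphi|i]; last exact: measurable_cst.
rewrite /ray_constraints /=.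
by case: (P _ _); [exact: s_meas|exact: measurable_cst].
Qed.

Definition ray_set P := [set x | feasible C (ray_constraints P) x !=set0].

Lemma measurable_ray_set P : measurable (ray_set P).
Proof.
exact: measurable_feasible Cball Ccompact Bsep C0 _ (measurable_ray_constraints P).
Qed.

Lemma sum_half_powers m (rho : R) :
  \sum_(j < m) rho / 2 ^+ j.+1 = rho - rho / 2 ^+ m.
Proof.
elim: m => [|m IH]; first by rewrite big_ord0 expr0 divr1 subrr.
rewrite big_ord_recr /= IH exprS invfM; move: (2 ^+ m)^-1 => z; lra.
Qed.

(** Only finitely many pairs are kept; with [l < m], an interval beginning before time [n] ends
    before [n + m]. *)
Definition ray_window (K : nat -> nat) m j l := [&& (j < m)%N, (l < m)%N & (K j <= l)%N].

(** A functional nearly norming [s x 0 (n + m)] is shifted to the points [iter k tau x] with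
    [k < n]. If such a point lies outside the ray set, then [k] is a bad time for some [j < m].
    Integrating the count bounds [n] times the measure by [n * rho] plus a constant. *)
Lemma ray_window_set_measure (rho : R) : 0 < rho -> exists K : nat -> nat,
  forall m, fine (mu (~` ray_set (ray_window K m))) <= rho.
Proof.
move=> rho0.
have /choice[Kc hKc] : forall j : nat, exists Kc : nat * R, forall n,
  exists H : X -> R, [/\ Rintegrable mu H,
    \int[mu]_x H x <= n%:R * (rho / 2 ^+ j.+1) + Kc.2 &
    forall x phi, C phi -> a n x - 1 <= phi (s x 0%N n) ->
      \sum_(k < n) (bad_time Kc.1 j.+1%:R^-1 n x phi k)%:R <= H x].
  move=> j; have e0 : 0 < j.+1%:R^-1 :> R by rewrite invr_gt0.
  have r0 : 0 < rho / 2 ^+ j.+1 by rewrite divr_gt0// exprn_gt0.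
  by have [K [c h]] := bad_times_bound e0 r0; exists (K, c).
exists (fun j => (Kc j).1) => m.
set G := ray_set _; have mG : measurable (~` G) by exact/measurableC/measurable_ray_set.
apply: (@le_linear_slope _ _ _ (m%:R * rho + \sum_(j < m) (Kc j).2)) => n.
(* Norming is available for positive lengths, so [n + m = 0] is treated apart. *)
have [/eqP|n0] := posnP (n + m)%N.
  rewrite addn_eq0 => /andP[/eqP -> /eqP m0].
  by rewrite m0 big_ord0 !mul0r !addr0.
have /choice[H hH] : forall j, exists H : X -> R, [/\ Rintegrable mu H,
    \int[mu]_x H x <= (n + m)%:R * (rho / 2 ^+ j.+1) + (Kc j).2 &
    forall x phi, C phi -> a (n + m)%N x - 1 <= phi (s x 0%N (n + m)%N) ->
      \sum_(k < n + m) (bad_time (Kc j).1 j.+1%:R^-1 (n + m) x phi k)%:R <= H x].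
  by move=> j; exact: hKc.
have Gi := Rintegrable_indic mu mG.
have Hi : Rintegrable mu (fun x => \sum_(j < m) H j x).
  by apply: Rintegrable_sum => j; case: (hH j).
have : \int[mu]_x birkhoff_sum tau (\1_(~` G)) n x <= \int[mu]_x \sum_(j < m) H j x.
  apply: ae_le_RintegralT => //; first exact: Rintegrable_birkhoff_sum.
  apply: filterS (s_norming n0) => x [phi Cphi hphi].
  apply: le_trans (_ : \sum_(j < m)
    \sum_(k < n + m) (bad_time (Kc j).1 j.+1%:R^-1 (n + m) x phi k)%:R <= _); last first.
    by apply: ler_sum => j _; have [_ _] := hH j; exact.
  rewrite exchange_big /= big_split_ord /= -[leLHS]addr0; apply: lerD; last first.
    by apply: sumr_ge0 => k _; apply: sumr_ge0.
  apply: ler_sum => k _; rewrite indicE.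
  have [nGk|Gk] := boolP (_ \in _); last by apply: sumr_ge0.
  move: nGk; rewrite inE /= => nGk.
  have [[j bj]|nb] := pselect (exists j : 'I_m,
      bad_time (Kc j).1 j.+1%:R^-1 (n + m) x phi k).
    by rewrite (bigD1 j)//= bj lerDl; exact: sumr_ge0.
  (* If no [j] were bad, the shifted functional would satisfy the whole window at [iter k tau x]. *)
  exfalso; apply: nGk; have [psi Cpsi hpsi] := C_shift k x Cphi.
  exists psi; apply/feasible_rayP; split => // j l /and3P[jm lm Kl].
  rewrite leNgt; apply/negP => hlt; apply: nb; exists (Ordinal jm).
  have lnm : (l < (n + m).+1)%N by rewrite ltnS (leq_trans (ltnW lm))// leq_addl.
  apply/existsP; exists (Ordinal lnm) => /=; rewrite Kl /=; apply/andP; split.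
    by rewrite leq_add// ltnW.
  by rewrite hpsi add0n addnC in hlt.
rewrite RintegralT_birkhoff_sum// RintegralT_indic// RintegralT_sum; last first.
  by move=> j; case: (hH j).
move=> /le_trans; apply.
apply: le_trans (ler_sum _ (G := fun j : 'I_m => (n + m)%:R * (rho / 2 ^+ j.+1) + (Kc j).2) _) _.
  by move=> j _; case: (hH j).
rewrite big_split /= addrA lerD2r -mulr_sumr sum_half_powers natrD -mulrDl.
rewrite ler_wpM2l// gerBl divr_ge0 ?exprn_ge0//; exact: ltW.
Qed.

(** Compactness turns functionals for all finite windows into one for all pairs. The complement is
    thus an increasing union of complements for windows, and their common bound passes to it. *)
Lemma ray_set_measure (rho : R) : 0 < rho -> exists K : nat -> nat,
  (mu (~` ray_set (fun j l => (K j <= l)%N)) <= rho%:E)%E.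
Proof.
move=> /ray_window_set_measure[K hK]; exists K.
have -> : ~` ray_set (fun j l => (K j <= l)%N) =
    \bigcup_m ~` ray_set (ray_window K m).
  rewrite -setC_bigcap; congr (~` _); apply/seteqP; split => x.
    move=> [phi /feasible_rayP[Cphi h]] m _; exists phi; apply/feasible_rayP; split => //.
    by move=> j l /and3P[_ _]; exact: h.
  move=> hx; have /choice[phi_ hphi_] : forall m, exists phi,
      feasible C (ray_constraints (ray_window K m)) x phi by move=> m; exact: (hx m I).
  have [phi Cphi hphi] := compact_seq_cluster Ccompact (fun n => (hphi_ n).1).
  exists phi; apply/feasible_rayP; split => // j l Kl; apply: hphi => e e0.
  exists (maxn j l).+1 => n; rewrite gtn_max => /andP[jn ln].
  have /feasible_rayP[_ /(_ j l)] := hphi_ n.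
  by rewrite /ray_window jn ln Kl => /(_ isT); apply: le_trans; rewrite gerBl ltW.
have mG m : measurable (~` ray_set (ray_window K m)).
  exact/measurableC/measurable_ray_set.
have /cvg_lim <-// : mu (~` ray_set (ray_window K m)) @[m --> \oo] -->
    mu (\bigcup_m ~` ray_set (ray_window K m)).
  apply: nondecreasing_cvg_mu => //; first exact: bigcupT_measurable.
  move=> m n mn; apply/subsetPset; apply: subsetC => x [phi /feasible_rayP[Cphi h]].
  exists phi; apply/feasible_rayP; split => // j l /and3P[jm lm Kl]; apply: h.
  by rewrite /ray_window Kl andbT (leq_trans jm)// (leq_trans lm).
apply: lime_le.
  apply: ereal_nondecreasing_is_cvgn => m n mn; apply: le_measure; rewrite ?inE//.
  apply: subsetC => x [phi /feasible_rayP[Cphi h]].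
  exists phi; apply/feasible_rayP; split => // j l /and3P[jm lm Kl]; apply: h.
  by rewrite /ray_window Kl andbT (leq_trans jm)// (leq_trans lm).
apply: nearW => m; rewrite -[leLHS]fineK ?lee_fin ?hK//.
exact: fin_num_measure.
Qed.

Lemma measurable_glue (E_ : nat -> set X) (xi_ : nat -> X -> B -> R) :
  (forall r, measurable (E_ r)) ->
  (forall r b, measurable_fun setT (fun x => xi_ r x b)) ->
  exists rk : X -> nat, (forall x, (\bigcup_r E_ r) x -> E_ (rk x) x) /\
    forall b, measurable_fun setT (fun x => xi_ (rk x) x b).
Proof.
move=> mE mxi.
(* The first index [r] with [x] in [E_ r], and 0 outside the union. *)
pose rk x := xget 0%N (fun r => seqDU E_ r x).
have rkE x r : seqDU E_ r x -> rk x = r.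
  move=> Er; rewrite /rk; case: xgetP => [r' _ Er'|/(_ r)//].
  by apply: (trivIset_seqDU E_) => //; exists x.
exists rk; split => [x|b].
  rewrite seqDU_bigcup_eq => -[r _ Er].
  by rewrite (rkE _ _ Er); case: Er.
have mS r : measurable (seqDU E_ r).
  by apply: measurableD => //; exact: bigsetU_measurable.
apply: measurable_fun_sublevel => t.
rewrite (_ : [set x | _] =
  (\bigcup_r (seqDU E_ r `&` [set x | xi_ r x b <= t])) `|`
  (~` (\bigcup_r E_ r) `&` [set x | xi_ 0%N x b <= t])).
  have ml r : measurable [set x | xi_ r x b <= t].
    rewrite (_ : [set x | _] = (fun x => xi_ r x b) @^-1` `]-oo, t]).
      by rewrite -[X in measurable X]setTI; exact: mxi.
    by apply/seteqP; split => x /=; rewrite in_itv.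
  apply: measurableU; first by apply: bigcupT_measurable => r; exact: measurableI.
  by apply: measurableI => //; apply: measurableC; exact: bigcupT_measurable.
have rk0 x : ~ (\bigcup_r E_ r) x -> rk x = 0%N.
  rewrite seqDU_bigcup_eq => nE; rewrite /rk; case: xgetP => // r _ Er.
  by exfalso; apply: nE; exists r.
apply/seteqP; split => x /=.
  move=> hx; have [Ex|nEx] := pselect ((\bigcup_r E_ r) x); last first.
    by right; split => //; rewrite -(rk0 x nEx).
  left; move: (Ex); rewrite seqDU_bigcup_eq => -[r _ Er].
  by exists r => //; split => //; rewrite /= -(rkE _ _ Er).
move=> [[r _ [Er]]|[nEx]] /=; first by rewrite (rkE _ _ Er).
by rewrite rk0.
Qed.

(** Selections on ray sets with complements of measure at most [1/(r+1)] are glued. The constraints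
    bound the growth rate from below by [L], and [kingman_upper] bounds it from above. *)
Lemma exists_measurable_ray : exists xi : X -> B -> R, [/\ forall x, C (xi x),
  forall b, measurable_fun setT (fun x => xi x b) &
  {ae mu, forall x, (fun n => xi x (s x 0%N n) / n%:R) @ \oo --> L}].
Proof.
have /choice[K hK] : forall r : nat, exists K : nat -> nat,
    (mu (~` ray_set (fun j l => (K j <= l)%N)) <= (r.+1%:R^-1)%:E)%E.
  by move=> r; apply: ray_set_measure; rewrite invr_gt0.
pose P r j l := (K r j <= l)%N.
have /choice[xi_ hxi_] : forall r, exists xi : X -> B -> R, [/\ forall x, C (xi x),
    forall x, ray_set (P r) x -> feasible C (ray_constraints (P r)) x (xi x) &
    forall b, measurable_fun setT (fun x => xi x b)].
  move=> r; exact: partial_measurable_selection Cball Ccompact Bsep C0 _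
    (measurable_ray_constraints (P r)).
have [rk [hrk mrk]] := @measurable_glue (fun r => ray_set (P r)) xi_
  (fun r => measurable_ray_set (P r)) (fun r b => let: And3 _ _ h := hxi_ r in h b).
exists (fun x => xi_ (rk x) x); split => //; first by move=> x; case: (hxi_ (rk x)).
have aeE : {ae mu, forall x, (\bigcup_r ray_set (P r)) x}.
  exists (~` \bigcup_r ray_set (P r)); split => //.
    by apply: measurableC; apply: bigcupT_measurable => r; exact: measurable_ray_set.
  apply/eqP; rewrite eq_le measure_ge0 andbT; apply/lee_addgt0Pr => e e0.
  rewrite add0e; have [r hr] := invS_le e0.
  apply: le_trans (_ : mu (~` ray_set (P r)) <= _)%E.
    apply: le_measure; rewrite ?inE.
    - by apply: measurableC; apply: bigcupT_measurable => k; exact: measurable_ray_set.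
    - by apply: measurableC; exact: measurable_ray_set.
    - by apply: subsetC => x Ex; exists r.
  by apply: le_trans (hK r) _; rewrite lee_fin.
have up := kingman_upper mtau ptau erg sD s_shift s_int A_linear.
apply: filterS2 aeE up => x Ex up.
have [Cxi /(_ _ (hrk _ Ex)) /feasible_rayP[_ hlow] _] := hxi_ (rk x).
apply: linear_upper_cvg.
  by apply: linear_upperW up => n; apply: dual_ball_le; exact: Cball.
move=> e e0; have [j hj] := invS_le e0; exists (K (rk x) j) => n Kn.
have := hlow j n Kn.
have : n%:R * j.+1%:R^-1 <= n%:R * e :> R by rewrite ler_wpM2l.
move: (j.+1%:R^-1) => q; lra.
Qed.

End Rays.

(** On the set [Z] where all of [C] misses the norm by [e], every choice of functionals loses at
    least [e]. The supremum then stays below the integral of the norm by [e] times the measure of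
    [Z], which must vanish. *)
Lemma sup_integral_norming {R : realType} {d : measure_display} {X : measurableType d}
    (mu : probability X R) {B : normedModType R} (C : set (B -> R)) (y : X -> B) e :
  C `<=` dual_ball -> separable_space B -> C !=set0 -> 0 < e ->
  Rintegrable mu (fun x => `|y x|) ->
  (forall phi, C phi -> measurable_fun setT (fun x => phi (y x))) ->
  (\int[mu]_x (`|y x|)%:E <= ereal_sup [set \int[mu]_x (lam x (y x))%:E |
     lam in [set lam : X -> B -> R | forall x, C (lam x)]])%E ->
  {ae mu, forall x, exists2 phi, C phi & `|y x| - e <= phi (y x)}.
Proof.
move=> Cball Bsep C0 e0 yi ym ysup.
have [D [CD hD]] := compact_dense_seq Cball Bsep C0.
pose Z := \bigcap_i [set x | D i (y x) < `|y x| - e].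
have mZ : measurable Z.
  apply: bigcapT_measurable => i; apply: measurable_ltr; first exact: ym.
  by apply: measurable_funB; [exact: Rintegrable_measurable yi|exact: measurable_cst].
have Zi := RintegrableZ e (Rintegrable_indic mu mZ).
have gi := RintegrableB yi Zi.
have : ((\int[mu]_x `|y x|)%:E <= (\int[mu]_x (`|y x| - e * \1_Z x))%:E)%E.
  rewrite EFin_RintegralT//; apply: le_trans ysup _.
  apply: ge_ereal_sup => _ [lam lamC <-].
  rewrite EFin_RintegralT//; apply: le_integral_pointwise => x; rewrite lee_fin.
  have lamB := Cball _ (lamC x).
  rewrite indicE; have [|_] := boolP (x \in Z); last first.
    by rewrite mulr0 subr0; exact: dual_ball_le.
  rewrite inE mulr1 => Zx; apply/ler_addgt0Pr => t t0.
  have [i /(_ 0%N isT)] := hD _ (lamC x) 1%N (fun=> y x) t t0.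
  by have := Zx i I; rewrite /= ltr_norml => h1 /andP[h2 h3]; lra.
rewrite lee_fin RintegralTB// RintegralTZ; last exact: Rintegrable_indic.
rewrite RintegralT_indic// => h.
have muZ : fine (mu Z) <= 0 by rewrite -(pmulr_rle0 _ e0); move: h; lra.
have Z0 : mu Z = 0%E.
  rewrite -[LHS]fineK ?fin_num_measure//; congr EFin.
  by apply/eqP; rewrite eq_le muZ fine_ge0.
exists Z; split => // x /= hx i _; rewrite /= ltNge; apply/negP => hi.
by apply: hx; exists (D i).
Qed.

(** * Passage from the [Z]-action to forward time *)

Unset Implicit Arguments.

Theorem mainTheorem8 (R : realType) (d : measure_display) (X : measurableType d)
  (mu : probability X R) (T : int -> X -> X)
  (B : completeNormedModType R)
  (c : int -> X -> B -> B) (s : X -> int -> int -> B) (C : set (B -> R)) :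
  (* standard probability space with an ergodic m.p. Z-action *)
  standard_borel R X ->
  (forall x, T 0 x = x) ->
  (forall n m x, T (n + m) x = T n (T m x)) ->
  (forall n, measurable_fun setT (T n)) ->
  (forall n A, measurable A -> mu (T n @^-1` A) = mu A) ->
  (forall A, measurable A -> (forall n, T n @^-1` A = A) ->
     mu A = 0%E \/ mu A = 1%E) ->
  (* B separable with the Radon--Nikodym property *)
  separable_space B -> RNP B ->
  (* Borel cocycle into Isom(B) *)
  (forall n x, lin_isometry (c n x)) ->
  (forall n m x b, c (n + m) x b = c n x (c m (T n x) b)) ->
  (forall n b, borel_meas (fun x => c n x b)) ->
  (* the function s *)
  (forall x m l n, s x m l + s x l n = s x m n) ->
  (forall k x m n, c k x (s (T k x) m n) = s x (m + k) (n + k)) ->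
  (forall m n phi, is_dual phi -> measurable_fun setT (fun x => phi (s x m n))) ->
  (forall n, mu.-integrable setT (fun x => (`|s x 0 n|)%:E)) ->
  (* the weak*-compact set C in the unit ball of B^* *)
  (forall phi, C phi -> is_dual phi /\ forall b, `|phi b| <= `|b|) ->
  compact (C : set {ptws B -> R}) ->
  (forall n x phi, C phi -> C (fun b => phi (c n x b))) ->
  (forall n : nat, (1 <= n)%N ->
     (\int[mu]_x (`|s x 0 n%:Z|)%:E =
      ereal_sup [set (\int[mu]_x (lam x (s x 0 n%:Z))%:E)%E
                | lam in [set lam : X -> B -> R | (forall x, C (lam x)) /\
                            forall b, measurable_fun setT (fun x => lam x b)]])%E) ->
  exists xi : X -> B -> R,
    (forall x, C (xi x)) /\ (forall b, measurable_fun setT (fun x => xi x b)) /\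
    exists L : R,
      (fun n : nat => fine (\int[mu]_x (`|s x 0 n%:Z|)%:E) / n%:R) @ \oo --> L /\
      {ae mu, forall x, (fun n : nat => xi x (s x 0 n%:Z) / n%:R) @ \oo --> L}.
Proof.
move=> _ T0 TD mT pT ergT Bsep _ cI _ _ sD sc smeas sint Cd Ccomp Cinv Csup.
pose tau := T 1; pose S x (m n : nat) := s x m%:Z n%:Z.
have mtau : measurable_fun setT tau by exact: mT.
have ptau A : measurable A -> mu (tau @^-1` A) = mu A by exact: pT.
have iterT k x : iter k tau x = T k%:Z x.
  by elim: k => [|k IH]; rewrite ?T0//= IH /tau -TD -intS.
have erg A : measurable A -> tau @^-1` A = A -> mu A = 0%E \/ mu A = 1%E.
  (* Ergodicity is stated for the whole action, so a [tau]-invariant set is shown to be invariant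
     under every [T n], negative times being inverses of positive ones. *)
  move=> mA tauA; apply: ergT => // n.
  have preT (k : nat) : T k%:Z @^-1` A = A.
    elim: k => [|k IH]; first by apply/seteqP; split => x /=; rewrite T0.
    rewrite -[RHS]IH -[in RHS]tauA; apply/seteqP; split => x /=;
    by rewrite /tau -TD -intS.
  case: n => k; first exact: preT.
  rewrite -{1}(preT k.+1) NegzE; apply/seteqP; split => x /=;
  by rewrite -TD addrN T0.
have Cball : C `<=` dual_ball by move=> phi /Cd.
have SD x m l n : S x m l + S x l n = S x m n by exact: sD.
have S_shift k x m n : `|S (iter k tau x) m n| = `|S x (m + k)%N (n + k)%N|.
  by rewrite iterT /S !PoszD -sc; have [_ [-> _]] := cI k%:Z x.
have S_int n : Rintegrable mu (fun x => `|S x 0%N n|) by exact: sint.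
have C0 : C !=set0.
  (* If [C] were empty, no [lam] would exist, as [X] has measure 1 and so has points; the supremum
     would be [-oo], but the integral is nonnegative. *)
  apply/set0P/eqP => C_empty.
  have := Csup 1%N isT.
  rewrite (_ : [set _ | _ in _] = set0).
    rewrite ereal_sup0 => h.
    have : (0 <= \int[mu]_x (`|s x 0 1%:Z|)%:E)%E by exact: integral_ge0.
    by rewrite h leNgt ltNye.
  apply/seteqP; split => // t [lam [lamC _] _].
  have [/eqP|/set0P[x _]] := eqVneq [set: X] set0; last first.
    by have := lamC x; rewrite C_empty.
  move=> /eqP X0; have := probability_setT mu; rewrite X0 measure0 => /eqP.
  by rewrite eq_sym onee_eq0.
have S_meas n phi : C phi -> measurable_fun setT (fun x => phi (S x 0%N n)).
  by move=> /Cd[dphi _]; exact: smeas.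
have S_norming n : (0 < n)%N -> {ae mu, forall x, exists2 phi, C phi &
    `|S x 0%N n| - 1 <= phi (S x 0%N n)}.
  move=> n0; apply: sup_integral_norming => //; first by move=> phi; exact: S_meas.
  (* Admitting all maps into [C] can only enlarge the supremum. *)
  rewrite /S (Csup n n0); apply: ereal_sup_le => _ [lam [lamC _] <-].
  by exists lam.
have C_shift k x phi : C phi -> exists2 psi, C psi &
    forall m n, psi (S (iter k tau x) m n) = phi (S x (m + k)%N (n + k)%N).
  (* The adjoint of the cocycle carries [phi] to the shifted point and preserves [C]. *)
  move=> Cphi; exists (fun b => phi (c k%:Z x b)); first exact: Cinv.
  by move=> m n; rewrite iterT /S !PoszD -sc.
have [L L_le A_lin] := fekete (Rintegral_norm_ge0 mu S)
  (Rintegral_normD mtau ptau SD S_shift S_int).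
have [xi [xiC xim xilim]] := exists_measurable_ray mtau ptau erg SD S_shift S_int
  Cball Ccomp Bsep C0 C_shift S_meas S_norming L_le A_lin.
exists xi; split => //; split => //; exists L; split => //.
(* The bound [n * L <= A n] gives the other half of the limit. *)
apply: (linear_upper_cvg A_lin) => e e0; exists 0%N => n _.
have := L_le n; have : 0 <= n%:R * e by rewrite mulr_ge0// ltW.
rewrite /Rintegral; lra.
Qed.
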